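(* Let $n\geq 3$ and let $L,K\subset \mathbb{R}^n$ be $O$-symmetric convex bodies with $L\subset\operatorname{int} K$. Suppose that every $x\in \operatorname{bd} K$ is a pole of $L$ and that, for every $x\in\operatorname{bd} K$, the set $\Omega_x:=S(L,x)\cap S(L,-x)$ is contained in $\operatorname{int} K$. Then $L$ is an ellipsoid.
   Context: A convex body in $\mathbb{R}^n$ is a compact convex set with nonempty interior; $\operatorname{int}$ and $\operatorname{bd}$ denote interior and boundary. $O$ is the origin, and a set $M$ is $O$-symmetric if $M=-M$. For a convex body $L$ and $x\in\mathbb{R}^n\setminus L$, let $C(L,x):=\{x+\lambda(y-x): y\in L,\ \lambda\geq 0\}$; the support cone $S(L,x)$ is the boundary of $C(L,x)$. Poles: complete $\mathbb{R}^n$ to the $n$-dimensional projective space $\mathbb{P}^n$ by adding the hyperplane at infinity. A point $q$ is a pole of $L$ if there is a hyperplane $H$ of $\mathbb{P}^n$ (the polar of $q$) such that for every line $\ell$ through $q$ with $\operatorname{bd} L\cap \ell=\{A,B\}$ (two distinct points), the cross ratio satisfies $[A,B;\,q,\ \ell\cap H]=-1$. *)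

(* Defs.v *)
From HB Require Import structures.
From mathcomp Require Import all_boot all_order all_algebra ring.
From mathcomp Require Import all_classical all_reals all_analysis.

Set Implicit Arguments.
Unset Strict Implicit.
Unset Printing Implicit Defensive.

Import Order.TTheory GRing.Theory Num.Theory.
Import numFieldNormedType.Exports.

Local Open Scope classical_set_scope.
Local Open Scope ring_scope.

Section ConvexBodies.
Variables (R : realType) (n : nat).
Implicit Types (L M : set 'rV[R]_n) (x y : 'rV[R]_n).

Definition boundary M : set 'rV[R]_n := closure M `\` M°.

Definition convex_body M : Prop :=
  [/\ compact M, convex_set M & M° !=set0].

Definition origin_symmetric M : Prop := M = [set - x | x in M].

Definition cone L x : set 'rV[R]_n :=
  [set z | exists y (t : R), [/\ L y, 0 <= t & z = x + t *: (y - x)]].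

Definition support_cone L x : set 'rV[R]_n := boundary (cone L x).

(* A solid ellipsoid: the image of the closed Euclidean unit ball under an
   invertible affine map. The library norm on 'rV[R]_n is the sup norm,
   so the Euclidean ball is spelled out. *)
Definition ellipsoid M : Prop :=
  exists (c : 'rV[R]_n) (T : 'M[R]_n), T \in unitmx /\
    M = [set c + y *m T | y in [set y : 'rV[R]_n | \sum_i y 0 i ^+ 2 <= 1]].

End ConvexBodies.

(* The projective space P^n over R is the lattice of linear subspaces of
   R^(n+1): points, lines and hyperplanes are the subspaces of dimension
   1, 2 and n, and incidence is inclusion. *)
Section Projective.
Variables (R : realType) (n : nat).
Local Notation V := 'rV[R]_(n + 1).
Implicit Types (p q a b c d l H : {vspace V}).

Definition proj_point p : Prop := \dim p = 1%N.
Definition proj_line l : Prop := \dim l = 2.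
Definition proj_hyperplane H : Prop := \dim H = n.

(* The embedding of R^n as the complement of the hyperplane at infinity
   (the vectors with last coordinate zero). *)
Definition affine_point (x : 'rV[R]_n) : {vspace V} :=
  <[row_mx x (1%:M : 'M[R]_1)]>%VS.

(* The cross ratio [a, b; c, d] of collinear points with a <> b. If a, b are
   spanned by u, v and c, d by c0 u + c1 v, d0 u + d1 v, it is
   (c1 d0) / (c0 d1), whatever the spanning vectors (cross_ratioE);
   on an affine line with coordinate t this is
   ((tc - ta)(td - tb)) / ((tc - tb)(td - ta)). Where the cross ratio is
   infinite, this takes the value 0. *)
Definition cross_ratio a b c d : R :=
  let e := [tuple vpick a; vpick b] in
  (coord e 1 (vpick c) * coord e 0 (vpick d)) /
  (coord e 0 (vpick c) * coord e 1 (vpick d)).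

Lemma cross_ratioE (u v : V) (c0 c1 d0 d1 : R) : free [:: u; v] ->
  c0 *: u + c1 *: v != 0 -> d0 *: u + d1 *: v != 0 ->
  cross_ratio <[u]> <[v]> <[c0 *: u + c1 *: v]> <[d0 *: u + d1 *: v]> =
  (c1 * d0) / (c0 * d1).
Proof.
have pickE (w : V) : w != 0 -> exists2 k : R, k != 0 & vpick <[w]>%VS = k *: w.
  move=> w0; have /vlineP[k wk] := memv_pick <[w]>%VS; exists k => //.
  apply: contra w0 => /eqP k0; move/eqP: wk.
  by rewrite k0 scale0r vpick0 -dimv_eq0 dim_vline eqb0 negbK.
move=> uv c_neq0 d_neq0.
have u0 : u != 0 by apply: contraL uv => /eqP->; rewrite free_cons mem0v.
have v0 : v != 0.
  by move: uv; rewrite free_cons => /andP[_]; rewrite seq1_free.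
have [ku ku0 Eu] := pickE _ u0; have [kv kv0 Ev] := pickE _ v0.
have [kc kc0 Ec] := pickE _ c_neq0; have [kd kd0 Ed] := pickE _ d_neq0.
rewrite /cross_ratio Ec Ed.
set e := [tuple _; _].
have freeE : free e.
  move: uv; rewrite /e /= Eu Ev !free_cons !span_seq1 !span_nil memv0 nil_free.
  rewrite memv0 !scaler_eq0 (negPf kv0) v0 !andbT /=.
  apply: contra => /vlineP[k uk]; apply/vlineP; exists (ku^-1 * (k * kv)).
  by rewrite -scalerA -scalerA -uk scalerA mulVf// scale1r.
have coordE (k a b : R) (i : 'I_2) : coord e i (k *: (a *: u + b *: v)) =
    k * (if i == 0 then a / ku else b / kv).
  have -> : a *: u + b *: v = \sum_(j < 2) (if j == 0 then a / ku else b / kv)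
      *: e`_j.
    rewrite big_ord_recl big_ord1 /= Eu Ev !scalerA !divfK//.
  by rewrite linearZ /= coord_sum_free.
rewrite !coordE /=.
have [->|c00] := eqVneq c0 0; first by rewrite !(mul0r, mulr0, invr0).
have [->|d10] := eqVneq d1 0; first by rewrite !(mul0r, mulr0, invr0).
by field; rewrite ku0 kv0 kc0 kd0 c00 d10.
Qed.

(* The condition \dim (l :&: H) = 1 says that l meets H in a single point,
   without which the cross ratio would have no meaning. *)
Definition is_polar (L : set 'rV[R]_n) q H : Prop :=
  forall (l : {vspace V}) (A B : 'rV[R]_n),
    proj_line l -> (q <= l)%VS -> A != B ->
    boundary L `&` [set y | (affine_point y <= l)%VS] = [set A; B] ->
    proj_point (l :&: H)%VS /\
    cross_ratio (affine_point A) (affine_point B) q (l :&: H)%VS = -1.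

Definition is_pole (L : set 'rV[R]_n) q : Prop :=
  proj_point q /\ exists2 H, proj_hyperplane H & is_polar L q H.

End Projective.

(* Main.v *)
Require Import Defs.
From mathcomp Require Import all_boot all_order all_algebra ring lra.
From mathcomp Require Import all_classical all_reals all_analysis.
Import Order.TTheory GRing.Theory Num.Theory.
Import numFieldNormedType.Exports.
Local Open Scope classical_set_scope.
Local Open Scope ring_scope.

(* Let [U] be the open cone over the interior of [L] in R^(n+1). A pole [x]
   outside [L] gives a linear reflection with centre [x] that preserves [U] and,
   on each secant of [L] through [x], swaps the two boundary rays. If [A] and
   [B] are boundary points joined by a segment through the interior, the line
   [AB] leaves [K] at two poles, and the product of the two reflections scales
   the rays [A] and [B] by inverse factors, fixing a complement pointwise.

   Send a boundary point [e2] and its tangent hyperplane to infinity. The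
   boundary of [L] becomes the graph of a finite convex function [F], and the
   dilations that fix [e2] and another boundary point show that [F] is
   self-similar about every point [w0]: its deviation from some affine function
   is homogeneous of degree 2 for one factor [lam w0 > 1]. Commutators of such
   dilations are translations preserving the graph up to a shear; conjugation
   by a dilation makes them arbitrarily small, so [F] is a quadratic form. *)

Set Implicit Arguments.
Unset Strict Implicit.

Local Ltac vec := apply/rowP => ?; rewrite !mxE.

(** * Linear forms, and powers tending to 0 *)

Section ScalarForms.
Context {R : realType} {m : nat} {phi : 'rV[R]_m -> R}.
Hypothesis phi_lin : scalar phi.

Lemma scal0 : phi 0 = 0.
Proof. by have := phi_lin (-1) 0 0; rewrite scaler0 addr0 mulN1r addNr. Qed.

Lemma scalD u v : phi (u + v) = phi u + phi v.
Proof. by have := phi_lin 1 u v; rewrite scale1r mul1r. Qed.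

Lemma scalZ a u : phi (a *: u) = a * phi u.
Proof. by have := phi_lin a u 0; rewrite !addr0 scal0 addr0. Qed.

Lemma scalN u : phi (- u) = - phi u.
Proof. by rewrite -scaleN1r scalZ mulN1r. Qed.

Lemma scalB u v : phi (u - v) = phi u - phi v.
Proof. by rewrite scalD scalN. Qed.

End ScalarForms.

Lemma exprV_small {R : realType} (lam eps : R) :
  1 < lam -> 0 < eps -> exists k : nat, lam ^- k < eps.
Proof.
move=> lam1 eps0.
have lt1 : `|lam^-1| < 1.
  have lam0 : 0 < lam by lra.
  by rewrite gtr0_norm ?invr_gt0 // invf_lt1.
have /cvgrPdist_lt /(_ _ eps0) [k _ /(_ k (leqnn k))] := @cvg_expr R _ lt1.
rewrite sub0r normrN normrX ger0_norm ?invr_ge0; last by lra.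
by rewrite /= exprVn => ?; exists k.
Qed.

(** * Self-similar functions and quadratic forms *)

Section FunctionalEquation.
Context {R : realType} {m : nat}.
Implicit Types (u v w z tau : 'rV[R]_m) (f : 'rV[R]_m -> R).

(** With [g v := f (w0 + v) - f w0 - mu v] the equation reads [g (lam *: v) = lam ^+ 2 * g v]. The
    form [mu] stands in for the derivative of [f] at [w0], with no differentiability assumed. *)
Definition self_similar f w0 (lam : R) (mu : 'rV[R]_m -> R) : Prop :=
  [/\ 1 < lam, scalar mu & forall v,
    f (w0 + lam *: v) - f w0 - lam * mu v =
    lam ^+ 2 * (f (w0 + v) - f w0 - mu v)].

(** Iterating inwards gives [f (lam ^- k *: u) = lam ^- k * mu u] up to a term of order
    [lam ^- k ^+ 2]. A negative [mu u] would make [f] negative near 0, so the linear form [mu] is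
    nonnegative, hence zero. *)
Lemma self_similar0 f lam mu : f 0 = 0 -> (forall v, 0 <= f v) ->
  self_similar f 0 lam mu -> forall v, f (lam *: v) = lam ^+ 2 * f v.
Proof.
move=> f0 f_ge0 [lam1 mu_lin fE] v.
have shrink k u : f (lam ^- k *: u) - lam ^- k * mu u =
    lam ^- k ^+ 2 * (f u - mu u).
  elim: k u => [|k IH] u; first by rewrite expr0 invr1 scale1r expr1n !mul1r.
  have lam0 : lam != 0 by apply/eqP; lra.
  have := fE (lam ^- k.+1 *: u); rewrite !add0r f0 !subr0 scalerA.
  have -> : lam * lam ^- k.+1 = lam ^- k.
    by rewrite exprS invfM mulrA divff // mul1r.
  rewrite (scalZ mu_lin).
  have -> : lam * (lam ^- k.+1 * mu u) = lam ^- k * mu u.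
    by rewrite mulrA exprS invfM mulrA divff // mul1r.
  rewrite IH => H.
  apply: (mulfI (expf_neq0 2 lam0)); rewrite -H !exprS expr0.
  by field; rewrite lam0 expf_neq0.
have mu_ge0 u : 0 <= mu u.
  rewrite leNgt; apply/negP => mu_lt0.
  have pos : 0 < f u - mu u by have := f_ge0 u; lra.
  have eps0 : 0 < - mu u / (f u - mu u) by rewrite divr_gt0 //; lra.
  have [k ltk] := exprV_small lam1 eps0.
  have e0 : 0 < lam ^- k by rewrite invr_gt0 exprn_gt0 //; lra.
  have := shrink k u; have := f_ge0 (lam ^- k *: u).
  move: ltk; rewrite ltr_pdivlMr // => ltk.
  move: (lam ^- k) e0 ltk => e e0 ltk fe E.
  have : f (e *: u) = e * (e * (f u - mu u) + mu u) by lra.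
  have : e * (e * (f u - mu u) + mu u) < 0 by rewrite pmulr_rlt0 //; lra.
  lra.
have mu0 u : mu u = 0.
  by apply/eqP; rewrite eq_le mu_ge0 andbT -oppr_ge0 -(scalN mu_lin).
by have := fE v; rewrite !mu0 !add0r f0 !subr0 mulr0 subr0.
Qed.

(* The commutator of the two dilations under which the graph of [f] is
   invariant is a translation. *)
Lemma self_similar_translation f w0 lam mu lam' :
  1 < lam' -> (forall v, f (lam' *: v) = lam' ^+ 2 * f v) ->
  self_similar f w0 lam mu ->
  exists (k c : R), 0 < k /\
    forall z, f (z + k *: w0) = f z + k * mu z + c.
Proof.
move=> lam'1 f_hom [lam1 mu_lin fE].
have aff u : f (lam *: u + (1 - lam) *: w0) =
    lam ^+ 2 * f u + (lam - lam ^+ 2) * mu u +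
    ((1 - lam ^+ 2) * f w0 - (lam - lam ^+ 2) * mu w0).
  have := fE (u - w0).
  have -> : w0 + lam *: (u - w0) = lam *: u + (1 - lam) *: w0.
    by apply/rowP => i; rewrite !mxE; ring.
  have -> : w0 + (u - w0) = u by apply/rowP => i; rewrite !mxE; ring.
  rewrite (scalB mu_lin) => E.
  lra.
set c0 := (1 - lam ^+ 2) * f w0 - _ in aff.
pose k := (lam' - 1) * (lam - 1).
have k0 : 0 < k by rewrite mulr_gt0 //; lra.
have ll0 : lam != 0 /\ lam' != 0 by split; apply/eqP; lra.
have tr z : f (z - k *: w0) = f z - k * mu z +
   (lam' ^+ 2 * c0 - c0 - k * (lam - 1) * mu w0).
  (* [z] and [z - k *: w0] are the images of [u] under the dilations about 0 and [w0], composed in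
     the two orders. *)
  pose u := (lam * lam')^-1 *: (z + (lam - 1) *: w0).
  have zE : z = lam *: (lam' *: u) + (1 - lam) *: w0.
    by apply/rowP => i; rewrite !mxE; field; case: ll0 => -> ->.
  have zkE : z - k *: w0 = lam' *: (lam *: u + (1 - lam) *: w0).
    by rewrite zE; apply/rowP => i; rewrite !mxE /k; ring.
  rewrite zkE f_hom aff [in RHS]zE aff f_hom !(scalD mu_lin, scalZ mu_lin).
  rewrite /k; ring.
exists k, (- (lam' ^+ 2 * c0 - c0 - k * (lam - 1) * mu w0) + k * (k * mu w0)).
split=> // z.
have := tr (z + k *: w0); rewrite addrK !(scalD mu_lin, scalZ mu_lin) => E.
lra.
Qed.

(** Conjugating the translation by powers of the dilation about 0 gives translations of length
    [eta := lam ^- j * k] along [w0]. Each changes the deviation [E] from the claimed parabola by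
    order [eta ^+ 2], so about [r / eta] of them change it by order [eta]; the Lipschitz bound
    covers the remainder of [r] modulo [eta]. *)
Lemma translation_quadratic f w0 (mu : 'rV[R]_m -> R) (lam k c : R) :
  1 < lam -> (forall v, f (lam *: v) = lam ^+ 2 * f v) -> scalar mu ->
  (forall w tau, exists M : R, forall d, 0 <= d <= 1 ->
     `|f (w + d *: tau) - f w| <= M * d) ->
  0 < k -> (forall z, f (z + k *: w0) = f z + k * mu z + c) ->
  forall z (r : R), 0 <= r ->
    f (z + r *: w0) = f z + r * mu z + r ^+ 2 * mu w0 / 2.
Proof.
move=> lam1 f_hom mu_lin f_lip k0 tr z r r0.
have small j u : f (u + (lam ^- j * k) *: w0) =
    f u + lam ^- j * k * mu u + lam ^- j ^+ 2 * c.
  elim: j u => [|j IH] u.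
    by rewrite expr0 invr1 expr1n !mul1r.
  have lam0 : lam != 0 by apply/eqP; lra.
  have := IH (lam *: u).
  have -> : lam *: u + (lam ^- j * k) *: w0 =
      lam *: (u + (lam ^- j.+1 * k) *: w0).
    apply/rowP => i; rewrite !mxE exprS; field.
    by rewrite lam0 expf_neq0.
  rewrite !f_hom (scalZ mu_lin) => E.
  apply: (mulfI (expf_neq0 2 lam0)); rewrite E [lam ^+ j.+1]exprS; field.
  by rewrite lam0 expf_neq0.
pose E s := f (z + s *: w0) - f z - s * mu z - s ^+ 2 * mu w0 / 2.
suff : E r = 0 by rewrite /E => ?; lra.
have step j (i : nat) s : let eta := lam ^- j * k in
    E (s + i%:R * eta) = E s + i%:R * eta * (eta * (c / k ^+ 2 - mu w0 / 2)).
  move=> eta; elim: i => [|i IH]; first by rewrite !mul0r !addr0.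
  have -> : s + i.+1%:R * eta = (s + i%:R * eta) + eta.
    by rewrite -natr1; ring.
  have := small j (z + (s + i%:R * eta) *: w0).
  have -> : z + (s + i%:R * eta) *: w0 + (lam ^- j * k) *: w0 =
      z + (s + i%:R * eta + eta) *: w0.
    by apply/rowP => h; rewrite !mxE /eta; ring.
  rewrite (scalD mu_lin) (scalZ mu_lin) -/eta => H.
  have -> : E (s + i%:R * eta + eta) = E (s + i%:R * eta) +
      (lam ^- j ^+ 2 * c - eta ^+ 2 * mu w0 / 2).
    by rewrite /E H; field; rewrite expf_neq0 //; apply/eqP; lra.
  rewrite IH -natr1 /eta; field.
  by apply/andP; split; rewrite ?expf_neq0 //; apply/eqP; lra.
have [M Mlip] := f_lip z w0.
pose N := `|M| + `|mu z| + `|mu w0|.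
have E_lip s : 0 <= s <= 1 -> `|E s| <= N * s.
  move=> s01; have /andP[s0 s1] := s01.
  have H1 : `|f (z + s *: w0) - f z| <= `|M| * s.
    by apply: le_trans (Mlip _ s01) _; rewrite ler_wpM2r // ler_norm.
  have H2 : `|s * mu z| <= `|mu z| * s by rewrite normrM ger0_norm // mulrC.
  have H3 : `|s ^+ 2 * mu w0 / 2| <= `|mu w0| * s.
    have -> : s ^+ 2 * mu w0 / 2 = s * (s / 2) * mu w0 by field.
    have ss : 0 <= s * (s / 2) <= s by apply/andP; split; nra.
    have /andP[ss0 ss1] := ss.
    by rewrite normrM (ger0_norm ss0) mulrC ler_wpM2l.
  rewrite /E /N !mulrDl.
  apply: le_trans (ler_normB _ _) _; apply: lerD => //.
  by apply: le_trans (ler_normB _ _) _; apply: lerD.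
pose P := `|r| * `|c / k ^+ 2 - mu w0 / 2|.
have bound j : lam ^- j * k <= 1 -> `|E r| <= (N + P) * (lam ^- j * k).
  set eta := _ * k => eta1.
  have eta0 : 0 < eta by rewrite mulr_gt0 // invr_gt0 exprn_gt0 //; lra.
  pose i := Num.truncn (r / eta).
  have : i%:R <= r / eta < i.+1%:R.
    by apply: truncn_itv; rewrite divr_ge0 // ltW.
  rewrite ler_pdivlMr // ltr_pdivrMr // -natr1 => /andP[i1 i2].
  have -> : r = (r - i%:R * eta) + i%:R * eta by ring.
  rewrite step -/eta mulrDl; apply: le_trans (ler_normD _ _) _; apply: lerD.
    apply: le_trans (E_lip _ _) _; first by apply/andP; split; lra.
    by rewrite ler_wpM2l /N ?addr_ge0 //; lra.
  have ie0 : 0 <= i%:R * eta by rewrite mulr_ge0 // ltW.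
  rewrite normrM (ger0_norm ie0) normrM (gtr0_norm eta0) /P (ger0_norm r0).
  rewrite mulrCA [leRHS]mulrC.
  by rewrite ler_wpM2l ?(ltW eta0) // ler_wpM2r.
apply/eqP; rewrite -normr_le0 leNgt; apply/negP => Er.
have NP0 : 0 <= N + P by rewrite !addr_ge0 // /P mulr_ge0.
have e0 : 0 < Num.min 1 (`|E r| / (N + P + 1)) / k.
  by rewrite divr_gt0 // lt_min ltr01 /= divr_gt0 //; lra.
have [j] := exprV_small lam1 e0.
rewrite ltr_pdivlMr // lt_min => /andP[j1].
rewrite ltr_pdivlMr; last by lra.
have := bound j (ltW j1).
have : 0 < lam ^- j * k by rewrite mulr_gt0 // invr_gt0 exprn_gt0 //; lra.
move: (lam ^- j * k) => e; lra.
Qed.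

Definition polar_form f u v : R := f (u + v) - f u - f v.

Definition quadratic_form f : Prop :=
  (forall v, scalar (fun u => polar_form f u v)) /\
  (forall (r : R) v, f (r *: v) = r ^+ 2 * f v).

(** Homogeneity about 0 lets every [w] serve as a translation direction, so [f (z + w) - f z - f w]
    is the linear form [mu] belonging to [w]. *)
Lemma self_similar_quadratic f : f 0 = 0 -> (forall v, 0 <= f v) ->
  (forall w tau, exists M : R, forall d, 0 <= d <= 1 ->
     `|f (w + d *: tau) - f w| <= M * d) ->
  (forall w, exists lam mu, self_similar f w lam mu) ->
  quadratic_form f.
Proof.
move=> f0 f_ge0 f_lip f_sim.
have [lam' [mu' sim0]] := f_sim 0.
have f_hom := self_similar0 f0 f_ge0 sim0.
have [lam'1 _ _] := sim0.
have quad w : exists2 mu, scalar mu & forall z r, 0 <= r ->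
    f (z + r *: w) = f z + r * mu z + r ^+ 2 * f w.
  have [lam [mu sim]] := f_sim w; have [_ mu_lin _] := sim.
  have [k [c [k0 tr]]] := self_similar_translation lam'1 f_hom sim.
  exists mu => // z r r0.
  have H := translation_quadratic lam'1 f_hom mu_lin f_lip k0 tr.
  have /eqP := H 0 1 ler01.
  rewrite (scal0 mu_lin) f0 scale1r !add0r mulr0 expr1n mul1r => /eqP fw.
  by rewrite H // fw add0r mulrA.
have fD w : exists2 mu, scalar mu & forall z, f (z + w) = f z + mu z + f w.
  have [mu mu_lin H] := quad w; exists mu => // z.
  by have := H z 1 ler01; rewrite scale1r expr1n !mul1r.
split=> [v|r v].
  have [mu mu_lin H] := fD v.
  move=> a x y; rewrite /polar_form !H mu_lin; ring.
have pos s : 0 <= s -> f (s *: v) = s ^+ 2 * f v.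
  have [mu mu_lin H] := quad v => s0.
  by have := H 0 s s0; rewrite !add0r f0 (scal0 mu_lin) mulr0 !add0r.
have [r0|r0] := leP 0 r; first exact: pos.
have -> : r *: v = - ((- r) *: v) by rewrite scaleNr opprK.
(* Evenness compares the expansions from [- u] along [u] at [r = 1], which reaches 0, and at
   [r = 2], which reaches [u]. *)
have even u : f (- u) = f u.
  have [mu mu_lin H] := quad u.
  have := H (- u) 1 ler01; rewrite scale1r addNr f0 (scalN mu_lin).
  have := H (- u) 2 (ler0n _ 2); rewrite (scalN mu_lin).
  have -> : - u + 2 *: u = u by apply/rowP => i; rewrite !mxE; ring.
  lra.
by rewrite even pos ?sqrrN //; lra.
Qed.

End FunctionalEquation.

(** * Open pointed convex cones and their dilations *)

Section ProperCone.
Context {R : realType} {m : nat}.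
Implicit Types (U : set 'rV[R]_m) (u v w p e z : 'rV[R]_m) (a b d k s t : R).

(* For an open convex cone [U], these are the vectors of its closure. *)
Definition recession U v : Prop := forall p, U p -> U (p + v).

(** [cone_open] asks for openness along lines only, which for a convex set in finite dimension is
    openness. [cone_pointed] forbids lines in the closure. *)
Record proper_cone U : Prop := ProperCone {
  coneD : forall u v, U u -> U v -> U (u + v);
  coneZ : forall k u, 0 < k -> U u -> U (k *: u);
  cone_open : forall p v, U p -> exists2 d, 0 < d & U (p + d *: v);
  cone_pointed : forall v, recession U v -> recession U (- v) -> v = 0
}.

Variable U : set 'rV[R]_m.
Hypothesis cU : proper_cone U.

Lemma cone_segment p v s t : U p -> U (p + s *: v) -> 0 <= t <= s ->
  U (p + t *: v).
Proof.
move=> Up Us /andP[t0 ts].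
have [->|tneq] := eqVneq t 0; first by rewrite scale0r addr0.
have [->//|sneq] := eqVneq t s.
have tp : 0 < t by rewrite lt_neqAle eq_sym tneq.
have sp : t < s by rewrite lt_neqAle sneq.
have -> : p + t *: v = (1 - t / s) *: p + (t / s) *: (p + s *: v).
  by vec; field; apply/eqP; lra.
have st : t / s < 1 by rewrite ltr_pdivrMr ?mul1r //; lra.
by apply: coneD => //; apply: coneZ => //; [lra|rewrite divr_gt0 //; lra].
Qed.

Lemma cone_small p v : U p ->
  exists2 d, 0 < d & forall t, 0 <= t <= d -> U (p + t *: v).
Proof.
move=> Up; have [d d0 Ud] := cone_open cU v Up; exists d => // t td.
exact: cone_segment Ud td.
Qed.

Lemma cone_recession v : U v -> recession U v.
Proof. by move=> Uv p Up; apply: coneD. Qed.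

Lemma recessionD u v : recession U u -> recession U v -> recession U (u + v).
Proof. by move=> Cu Cv p Up; rewrite addrA; apply: Cv; apply: Cu. Qed.

Lemma recessionZ k v : 0 <= k -> recession U v -> recession U (k *: v).
Proof.
rewrite le_eqVlt => /orP[/eqP<- _|k0 Cv] p Up.
  by rewrite scale0r addr0.
have -> : p + k *: v = k *: (k^-1 *: p + v).
  by vec; field; apply/eqP; lra.
by apply: coneZ => //; apply: Cv; apply: coneZ => //; rewrite invr_gt0.
Qed.

(** A closedness criterion along parabolic arcs, the shape in which iterated dilations approach
    their limit. The point [p] is split into two halves, which absorb [- eps *: w] and
    [- eps ^+ 2 *: u] by openness. *)
Lemma recession_closed z w u :
  (forall d, 0 < d -> exists2 eps, 0 < eps <= d &
     recession U (z + eps *: w + eps ^+ 2 *: u)) -> recession U z.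
Proof.
move=> H p Up.
have [d1 d10 H1] := cone_small (- 2 *: w) Up.
have [d2 d20 H2] := cone_small (- 2 *: u) Up.
have d0 : 0 < Num.min 1 (Num.min d1 d2) by rewrite !lt_min ltr01 d10.
have [eps /andP[eps0]] := H _ d0.
rewrite !le_min => /and3P[e1 e2 e3] Ce.
have -> : p + z = 2^-1 *: (p + eps *: (- 2 *: w)) +
    2^-1 *: (p + eps ^+ 2 *: (- 2 *: u)) + (z + eps *: w + eps ^+ 2 *: u).
  by vec; field.
apply: Ce; apply: coneD => //; apply: coneZ; rewrite ?invr_gt0 //.
  by apply: H1; rewrite ltW.
apply: H2; rewrite sqr_ge0 /=; apply: le_trans e3.
by rewrite expr2 ler_piMl // ltW.
Qed.

Lemma cone_combination e e' a b a' b' : recession U e -> recession U e' ->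
  0 < a -> 0 < b -> U (a *: e + b *: e') -> 0 < a' -> 0 < b' ->
  U (a' *: e + b' *: e').
Proof.
move=> Ce Ce' a0 b0 Uab a'0 b'0.
pose k := Num.min (a' / a) (b' / b).
have k0 : 0 < k by rewrite lt_min !divr_gt0.
have ka : k * a <= a' by rewrite -ler_pdivlMr // ge_min lexx.
have kb : k * b <= b' by rewrite -ler_pdivlMr // ge_min lexx orbT.
have -> : a' *: e + b' *: e' = k *: (a *: e + b *: e') +
    ((a' - k * a) *: e + (b' - k * b) *: e') by vec; ring.
have Cr : recession U ((a' - k * a) *: e + (b' - k * b) *: e').
  by apply: recessionD; apply: recessionZ; rewrite ?subr_ge0.
by apply: Cr; apply: coneZ.
Qed.

(** If the ray stayed in [U], so would [z + d *: p] for every [d > 0], and [z] would lie in the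
    closure. The exit point is taken at the supremum of the parameters in [U]. *)
Lemma cone_exit p z : U p -> ~ recession U z ->
  exists s, [/\ 0 < s, recession U (p + s *: z) & ~ U (p + s *: z)].
Proof.
move=> Up Nz.
have [s1 s10 N1] : exists2 s, 0 < s & ~ U (p + s *: z).
  apply/not_exists2P => H; apply: Nz.
  apply: (@recession_closed z p 0) => d d0; exists d; first by rewrite d0 lexx.
  rewrite scaler0 addr0.
  have -> : z + d *: p = d *: (p + d^-1 *: z) by vec; field; apply/eqP; lra.
  apply: cone_recession; apply: coneZ => //.
  by have [|/contrapT//] := H d^-1; rewrite invr_gt0.
pose S := [set s | 0 <= s /\ U (p + s *: z)].
have S0 : S 0 by split=> //; rewrite scale0r addr0.
have ubS : ubound S s1.
  move=> s [s0 Us]; rewrite leNgt; apply/negP => ss; apply: N1.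
  by apply: cone_segment Us _ => //; rewrite !ltW.
have supS : has_sup S by split; [exists 0|exists s1].
have below t : 0 <= t < sup S -> U (p + t *: z).
  move=> /andP[t0 ts].
  have ts0 : 0 < sup S - t by lra.
  have [s [s0 Us]] := sup_adherent ts0 supS.
  rewrite opprB addrCA subrr addr0 => st.
  by apply: cone_segment Us _ => //; rewrite t0 ltW.
have above t : S t -> t <= sup S by move=> St; apply: sup_upper_bound.
have sup0 : 0 < sup S.
  have [d d0 Ud] := cone_open cU z Up.
  by apply: (lt_le_trans d0); apply: above; split=> //; apply: ltW.
exists (sup S); split=> //.
  apply: (@recession_closed _ (- z) 0) => d d0.
  exists (Num.min d (sup S)); first by rewrite lt_min d0 sup0 ge_min lexx.
  rewrite scaler0 addr0; set eps := Num.min _ _.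
  have e0 : 0 < eps by rewrite lt_min d0 sup0.
  have e1 : eps <= sup S by rewrite ge_min lexx orbT.
  have -> : p + sup S *: z + eps *: - z = p + (sup S - eps) *: z by vec; ring.
  by apply: cone_recession; apply: below; apply/andP; split; lra.
move=> Us; have [d d0] := cone_open cU z Us.
rewrite -addrA -scalerDl => Ud.
have : S (sup S + d) by split=> //; lra.
by move/above; lra.
Qed.

(** Two boundary rays whose sector runs through [U]; over a body, these are two boundary points
    joined by a chord through the interior. *)
Definition opposite e e' : Prop :=
  [/\ recession U e, recession U e', ~ U e, ~ U e' & U (e + e')].

(** For dual forms [alpha] and [beta], this multiplies [e] by [lam^-1] and [e'] by [lam] and fixes
    the common kernel of the forms. *)
Definition dilate (alpha beta : 'rV[R]_m -> R) e e' (lam : R) v :=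
  v + ((lam^-1 - 1) * alpha v) *: e + ((lam - 1) * beta v) *: e'.

Record dilation e e' (alpha beta : 'rV[R]_m -> R) (lam : R) : Prop := Dilation {
  dil_gt1 : 1 < lam;
  dil_lin : scalar alpha;
  dil_lin' : scalar beta;
  dil_dual : [/\ alpha e = 1, alpha e' = 0, beta e = 0 & beta e' = 1];
  dil_cone : forall v, U v -> U (dilate alpha beta e e' lam v);
  dil_coneV : forall v, U v -> U (dilate alpha beta e e' lam^-1 v)
}.

Lemma opposite_sym e e' : opposite e e' -> opposite e' e.
Proof. by case=> *; split=> //; rewrite addrC. Qed.

Lemma dilation_sym e e' alpha beta lam :
  dilation e e' alpha beta lam -> dilation e' e beta alpha lam.
Proof.
case=> lam1 al bl [d1 d2 d3 d4] dU dU'; split=> // v Uv.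
- suff -> : dilate beta alpha e' e lam v = dilate alpha beta e e' lam^-1 v.
    exact: dU'.
  by rewrite /dilate invrK; vec; ring.
- suff -> : dilate beta alpha e' e lam^-1 v = dilate alpha beta e e' lam v.
    exact: dU.
  by rewrite /dilate invrK; vec; ring.
Qed.

Lemma dilate_iter e e' alpha beta lam (k : nat) v :
  dilation e e' alpha beta lam -> U v ->
  U (v + ((lam ^- k - 1) * alpha v) *: e + ((lam ^+ k - 1) * beta v) *: e').
Proof.
move=> [lam1 al bl [d1 d2 d3 d4] dU _] Uv.
elim: k => [|k IH].
  by rewrite expr0 invr1 subrr !mul0r !scale0r !addr0.
suff -> : v + ((lam ^- k.+1 - 1) * alpha v) *: e +
    ((lam ^+ k.+1 - 1) * beta v) *: e' = dilate alpha beta e e' lam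
  (v + ((lam ^- k - 1) * alpha v) *: e + ((lam ^+ k - 1) * beta v) *: e').
  exact: dU.
rewrite /dilate !(scalD al, scalD bl, scalZ al, scalZ bl) d1 d2 d3 d4 exprS.
have l0 : lam != 0 by apply/eqP; lra.
by vec; field; rewrite l0 expf_neq0.
Qed.

Lemma recession_iter e e' alpha beta lam (k : nat) v :
  dilation e e' alpha beta lam -> recession U v ->
  recession U
    (v + ((lam ^- k - 1) * alpha v) *: e + ((lam ^+ k - 1) * beta v) *: e').
Proof.
move=> dl Cv p Up.
have [lam1 al bl [d1 d2 d3 d4] _ _] := dl.
have l0 : lam != 0 by apply/eqP; lra.
(* [q] is the preimage of [p] under the [k]-th iterate, so applying the iterate to [q + v] yields
   [p] plus the image of [v]. *)
pose q := p + ((lam ^+ k - 1) * alpha p) *: e + ((lam ^- k - 1) * beta p) *: e'.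
have Uq : U q.
  have := dilate_iter k (dilation_sym dl) Up.
  by rewrite /q addrAC.
have := dilate_iter k dl (Cv _ Uq).
rewrite /q !(scalD al, scalD bl, scalZ al, scalZ bl) d1 d2 d3 d4.
congr U; vec; field; exact: expf_neq0.
Qed.

(** * Support forms of a cone with a dilation *)

Section Dilation.
Context {e e' : 'rV[R]_m} {alpha beta : 'rV[R]_m -> R} {lam : R}.
Hypothesis ee' : opposite e e'.
Hypothesis dl : dilation e e' alpha beta lam.

(** The iterates of [v], scaled by [lam ^- k], tend to [beta v *: e']. A negative [beta v] would put
    [- e'] in the closure, against pointedness. *)
Lemma recession_ge0 v : recession U v -> 0 <= beta v.
Proof.
move=> Cv; have [lam1 al bl [d1 d2 d3 d4] _ _] := dl.
have [Ce Ce' _ Ne' Uee'] := ee'.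
have l0 : lam != 0 by apply/eqP; lra.
rewrite leNgt; apply/negP => b0; apply: Ne'.
suff Cb : recession U (beta v *: e').
  suff e'0 : e' = 0 by move: Uee'; rewrite e'0 addr0 => Ue; case: ee'.
  apply: (cone_pointed cU) => //.
  have -> : - e' = (- beta v)^-1 *: (beta v *: e').
    by vec; field; apply/eqP; lra.
  by apply: recessionZ => //; rewrite invr_ge0; lra.
apply: (@recession_closed _ (v - alpha v *: e - beta v *: e') (alpha v *: e)).
move=> d d0; have [k ltk] := exprV_small lam1 d0.
have e0 : 0 < lam ^- k by rewrite invr_gt0 exprn_gt0 //; lra.
exists (lam ^- k); first by rewrite e0 ltW.
have := recessionZ (ltW e0) (recession_iter k dl Cv).
congr recession; vec; field; exact: expf_neq0.
Qed.

(** The support hyperplane at [e'] is unique. Iterating the dilation on [e + e' + d *: w], with [w]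
    in the common kernel of [alpha] and [beta], shrinks the [e]-part; since [psi] ignores [e'], this
    leaves [psi w >= 0], and by symmetry [psi w = 0]. *)
Lemma support_unique (psi : 'rV[R]_m -> R) : scalar psi ->
  (forall v, recession U v -> 0 <= psi v) -> psi e' = 0 ->
  forall v, psi v = psi e * alpha v.
Proof.
move=> pl psi0 psie'; have [lam1 al bl [d1 d2 d3 d4] _ _] := dl.
have [Ce Ce' Ne Ne' Uee'] := ee'.
have psiW w : alpha w = 0 -> beta w = 0 -> 0 <= psi w.
  move=> aw bw; rewrite leNgt; apply/negP => pw.
  have [d d0 Ud] := cone_open cU w Uee'.
  have pe := psi0 _ Ce.
  have eps0 : 0 < - (d * psi w) / (psi e + 1).
    by rewrite divr_gt0 //; [nra|lra].
  have [k ltk] := exprV_small lam1 eps0.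
  have := psi0 _ (cone_recession (dilate_iter k dl Ud)).
  rewrite !(scalD al, scalD bl, scalD pl, scalZ al, scalZ bl, scalZ pl).
  rewrite psie' aw bw d1 d2 d3 d4.
  have lk0 : 0 < lam ^- k by rewrite invr_gt0 exprn_gt0 //; lra.
  move: ltk; rewrite ltr_pdivlMr; last by lra.
  move: (lam ^- k) lk0 => x x0; nra.
have psiW0 w : alpha w = 0 -> beta w = 0 -> psi w = 0.
  move=> aw bw; apply/eqP; rewrite eq_le psiW // andbT -oppr_ge0 -(scalN pl).
  by apply: psiW; rewrite ?(scalN al) ?(scalN bl) ?aw ?bw oppr0.
move=> v; have := psiW0 (v - alpha v *: e - beta v *: e').
rewrite !(scalB al, scalB bl, scalB pl, scalZ al, scalZ bl, scalZ pl).
rewrite psie' d1 d2 d3 d4 => H.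
suff : psi v - alpha v * psi e - beta v * 0 = 0 by lra.
by apply: H; ring.
Qed.

End Dilation.

(** * A cone with all dilations is a quadric *)

Section Quadric.
Context {e1 e2 : 'rV[R]_m} {alpha beta : 'rV[R]_m -> R} {lam : R}.
Hypothesis e12 : opposite e1 e2.
Hypothesis dl : dilation e1 e2 alpha beta lam.
Hypothesis dilations : forall e e', opposite e e' ->
  exists alpha beta lam, dilation e e' alpha beta lam.

(* Locked so that rewriting with [scalD] does not unfold it. *)
Let pr v := locked (v - alpha v *: e1 - beta v *: e2).

Let alphaD := scalD (dil_lin dl).
Let alphaZ := scalZ (dil_lin dl).
Let betaD := scalD (dil_lin' dl).
Let betaZ := scalZ (dil_lin' dl).

Let alpha_pr v : alpha (pr v) = 0.
Proof.
rewrite /pr -!lock !(scalB (dil_lin dl)) !alphaZ.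
by have [-> -> _ _] := dil_dual dl; ring.
Qed.

Let beta_pr v : beta (pr v) = 0.
Proof.
rewrite /pr -!lock !(scalB (dil_lin' dl)) !betaZ.
by have [_ _ -> ->] := dil_dual dl; ring.
Qed.

Let prD u v : pr (u + v) = pr u + pr v.
Proof. by rewrite /pr -!lock alphaD betaD; vec; ring. Qed.

Let prZ a v : pr (a *: v) = a *: pr v.
Proof. by rewrite /pr -!lock alphaZ betaZ; vec; ring. Qed.

Let alpha_ge0 v : recession U v -> 0 <= alpha v.
Proof. exact: recession_ge0 (opposite_sym e12) (dilation_sym dl) v. Qed.

Let beta_ge0 v : recession U v -> 0 <= beta v.
Proof. exact: recession_ge0 e12 dl v. Qed.

(** In the chart [alpha = 1], with [e2] at infinity, [h] is the height over [pr w] of the boundary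
    of [U], seen as a graph. *)
Definition is_floor (w : 'rV[R]_m) (h : R) : Prop :=
  [/\ forall b, U (e1 + b *: e2 + pr w) <-> h < b,
      recession U (e1 + h *: e2 + pr w) & 0 <= h].

Lemma exists_floor w : exists h, is_floor w h.
Proof.
have [Ce1 Ce2 Ne1 Ne2 U12] := e12; have [d1 d2 d3 d4] := dil_dual dl.
have lam1 := dil_gt1 dl; have l0 : lam != 0 by apply/eqP; lra.
have [b0 Ub0] : exists b, U (e1 + b *: e2 + pr w).
  have [d d0 Ud] := cone_open cU (pr w) U12.
  have [k ltk] := exprV_small lam1 d0.
  have x0 : 0 < lam ^- k by rewrite invr_gt0 exprn_gt0 //; lra.
  have := dilate_iter k dl Ud.
  rewrite !(alphaD, betaD, alphaZ, betaZ) alpha_pr beta_pr d1 d2 d3 d4 => Uk.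
  pose s := lam ^- k / d.
  have s1 : s <= 1 by rewrite ler_pdivrMr // mul1r ltW.
  (* The iterate is [lam ^- k *: e1 + lam ^+ k *: e2 + d *: pr w]. Dividing by [d] leaves the
     coefficient [s <= 1] on [e1]; adding [(1 - s) *: e1], a vector of the closure, brings it to
     1. *)
  exists (d^-1 * lam ^+ k).
  have -> : e1 + (d^-1 * lam ^+ k) *: e2 + pr w =
    d^-1 *: (e1 + e2 + d *: pr w +
      ((lam ^- k - 1) * (1 + 0 + d * 0)) *: e1 +
      ((lam ^+ k - 1) * (0 + 1 + d * 0)) *: e2) + (1 - s) *: e1.
    by rewrite /s; vec; field; rewrite expf_neq0 // andbT; apply/eqP; lra.
  by apply: (recessionZ _ Ce1); [lra|apply: coneZ; rewrite ?invr_gt0].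
have Ne2' : ~ recession U (- e2).
  move=> H; apply: Ne1; move: U12; rewrite (cone_pointed cU Ce2 H) addr0.
  by [].
have [s [s0 Cs Ns]] := cone_exit Ub0 Ne2'.
have E b : e1 + b *: e2 + pr w + (b0 - b) *: e2 = e1 + b0 *: e2 + pr w.
  by vec; ring.
have E' : e1 + b0 *: e2 + pr w + s *: - e2 = e1 + (b0 - s) *: e2 + pr w.
  by vec; ring.
rewrite {}E' in Cs Ns.
have Uiff b : U (e1 + b *: e2 + pr w) <-> b0 - s < b.
  split=> [Ub|hb].
    rewrite ltNge; apply/negP => bh; apply: Ns.
    have -> : e1 + (b0 - s) *: e2 + pr w =
        (e1 + b *: e2 + pr w) + (b0 - s - b) *: e2 by vec; ring.
    by apply: (recessionZ _ Ce2) => //; rewrite subr_ge0.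
  have [lb|lb] := leP b0 b.
    have -> : e1 + b *: e2 + pr w =
        (e1 + b0 *: e2 + pr w) + (b - b0) *: e2 by vec; ring.
    by apply: (recessionZ _ Ce2) => //; rewrite subr_ge0.
  have -> : e1 + b *: e2 + pr w =
      ((b - (b0 - s)) / s) *: (e1 + b0 *: e2 + pr w) +
      ((b0 - b) / s) *: (e1 + (b0 - s) *: e2 + pr w).
    by vec; field; apply/eqP; lra.
  apply: (recessionZ _ Cs); first by rewrite divr_ge0 //; lra.
  by apply: coneZ => //; rewrite divr_gt0 //; lra.
exists (b0 - s); split=> //.
have := beta_ge0 Cs; rewrite !betaD betaZ beta_pr d3 d4; lra.
Qed.

(** [F] is the floor function. A dilation between [e2] and the boundary point above [w0] makes it
    self-similar at [w0], hence a quadratic form, and homogeneity turns [F < beta] at [alpha = 1]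
    into the inequality for all [alpha > 0]. *)
Lemma cone_quadric : exists F : 'rV[R]_m -> R,
  [/\ quadratic_form F, forall v, 0 <= F v,
      forall v a b, F (v + a *: e1 + b *: e2) = F v &
      forall v, U v <-> 0 < alpha v /\ F v < alpha v * beta v].
Proof.
have [Ce1 Ce2 Ne1 Ne2 U12] := e12; have [d1 d2 d3 d4] := dil_dual dl.
have lam1 := dil_gt1 dl; have l0 : lam != 0 by apply/eqP; lra.
have [F FP] := choice exists_floor.
have FU w b : U (e1 + b *: e2 + pr w) <-> F w < b by have [] := FP w.
have FC w : recession U (e1 + F w *: e2 + pr w) by have [] := FP w.
have F_ge0 w : 0 <= F w by have [] := FP w.
have F_le w b : recession U (e1 + b *: e2 + pr w) -> F w <= b.
  move=> Cb; rewrite leNgt; apply/negP => bF.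
  (* The midpoint of this point of [U] and the given one lies in [U] but below the floor. *)
  have : U (e1 + (F w + (F w - b) / 2) *: e2 + pr w) by apply/FU; lra.
  move/Cb/(coneZ cU (k := 2^-1)); rewrite invr_gt0 => /(_ (ltr0Sn _ _)).
  have -> : 2^-1 *: (e1 + (F w + (F w - b) / 2) *: e2 + pr w +
      (e1 + b *: e2 + pr w)) =
      e1 + (F w - (F w - b) / 4) *: e2 + pr w by vec; field.
  by move/FU; lra.
have F_pr u v : pr u = pr v -> F u = F v.
  move=> E; apply/eqP; rewrite eq_le; apply/andP; split; apply: F_le.
    by rewrite E; apply: FC.
  by rewrite -E; apply: FC.
have F0 : F 0 = 0.
  apply/eqP; rewrite eq_le F_ge0 andbT; apply: F_le.
  rewrite /pr -!lock (scal0 (dil_lin dl)) (scal0 (dil_lin' dl)).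
  by rewrite !scale0r !subr0 !addr0.
have F_convex u v t : 0 <= t <= 1 ->
    F ((1 - t) *: u + t *: v) <= (1 - t) * F u + t * F v.
  move=> /andP[t0 t1]; apply: F_le.
  have -> : e1 + ((1 - t) * F u + t * F v) *: e2 + pr ((1 - t) *: u + t *: v) =
      (1 - t) *: (e1 + F u *: e2 + pr u) + t *: (e1 + F v *: e2 + pr v).
    by rewrite prD !prZ; vec; ring.
  by apply: recessionD; apply: recessionZ; rewrite ?subr_ge0.
have F_lip w tau : exists M : R, forall d, 0 <= d <= 1 ->
    `|F (w + d *: tau) - F w| <= M * d.
  (* Convexity between [w] and [w + tau] bounds the increment above; [w] as a point between
     [w + d *: tau] and [w - tau] bounds it below. *)
  exists (`|F (w + tau) - F w| + `|F (w - tau) - F w|) => d d01.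
  have /andP[d0 d1'] := d01.
  have H1 := F_convex w (w + tau) d d01.
  have E1 : (1 - d) *: w + d *: (w + tau) = w + d *: tau by vec; ring.
  rewrite {}E1 in H1.
  have dd : 0 <= d / (1 + d) <= 1.
    by rewrite divr_ge0 ?ler_pdivrMr //=; lra.
  have H2 := F_convex (w + d *: tau) (w - tau) _ dd.
  have E2 : (1 - d / (1 + d)) *: (w + d *: tau) + (d / (1 + d)) *: (w - tau) =
      w.
    by vec; field; apply/eqP; lra.
  rewrite {}E2 in H2.
  have {}H2 : (1 + d) * F w <= F (w + d *: tau) + d * F (w - tau).
    have -> : F (w + d *: tau) + d * F (w - tau) = (1 + d) *
      ((1 - d / (1 + d)) * F (w + d *: tau) + d / (1 + d) * F (w - tau)).
      by field; apply/eqP; lra.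
    by rewrite ler_wpM2l //; lra.
  have n1 := ler_wpM2l d0 (ler_norm (F (w + tau) - F w)).
  have n2 := ler_wpM2l d0 (ler_norm (F (w - tau) - F w)).
  have p1 := mulr_ge0 d0 (normr_ge0 (F (w + tau) - F w)).
  have p2 := mulr_ge0 d0 (normr_ge0 (F (w - tau) - F w)).
  by rewrite ler_norml; apply/andP; split; lra.
have F_sim w0 : exists lam mu, self_similar F w0 lam mu.
  pose Q := e1 + F w0 *: e2 + pr w0.
  have NQ : ~ U Q by move/FU; rewrite ltxx.
  have op : opposite e2 Q.
    split=> //; first exact: FC.
    have -> : e2 + Q = e1 + (F w0 + 1) *: e2 + pr w0 by rewrite /Q; vec; ring.
    by apply/FU; lra.
  have [al' [be' [ka dl']]] := dilations op.
  have [ka1 al'_lin be'_lin [c1 c2 c3 c4] dU dU'] := dl'.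
  have alQ : alpha Q = 1 by rewrite /Q !alphaD alphaZ alpha_pr d1 d2; ring.
  (* [be'] and [alpha] are both support forms vanishing at [e2], hence proportional, and both are 1
     at [Q]. *)
  have be'E v : be' v = alpha v.
    have H := support_unique e12 dl be'_lin (recession_ge0 op dl') c3.
    have be'1 : be' e1 = 1 by rewrite -c4 (H Q) alQ mulr1.
    by rewrite (H v) be'1 mul1r.
  (* [al'] vanishes at [Q]; its kernel is a support hyperplane there, in the chart the graph of an
     affine function with this linear part. *)
  exists ka, (fun v => - al' (pr v)); split=> //.
    by move=> a u v; rewrite prD prZ al'_lin; ring.
  have step k : 0 < k ->
      (forall v, U v -> U (dilate al' be' e2 Q k v)) -> forall x,
      F (w0 + k^-1 *: x) <=
        F w0 + k^-1 ^+ 2 * (F (w0 + x) - F w0) +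
        (k^-1 ^+ 2 - k^-1) * al' (pr x).
    move=> k0 dUk x; rewrite leNgt; apply/negP.
    set rhs := (X in X < _) => lt_rhs.
    (* [b] is the height over [w0 + x] whose image under the dilation, scaled back by [k^-1], falls
       exactly on the floor over [w0 + k^-1 *: x]. *)
    pose b := F (w0 + x) + k ^+ 2 * (F (w0 + k^-1 *: x) - rhs).
    have bF : F (w0 + x) < b.
      by rewrite ltrDl mulr_gt0 ?exprn_gt0 // subr_gt0.
    have := dUk _ ((FU (w0 + x) b).2 bF).
    move/(coneZ cU (k := k^-1)); rewrite invr_gt0 => /(_ k0).
    have al'e1 : al' e1 = - F w0 - al' (pr w0).
      by move: c2; rewrite /Q !(scalD al'_lin, scalZ al'_lin) c1; lra.
    have k0' : k != 0 by apply/eqP; lra.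
    rewrite /dilate be'E !(alphaD, alphaZ) alpha_pr d1 d2.
    rewrite !(scalD al'_lin, scalZ al'_lin) al'e1 c1 prD (scalD al'_lin).
    suff -> : k^-1 *: (e1 + b *: e2 + (pr w0 + pr x) +
       ((k^-1 - 1) * (- F w0 - al' (pr w0) + b * 1 +
          (al' (pr w0) + al' (pr x)))) *: e2 +
       ((k - 1) * (1 + b * 0 + 0)) *: Q) =
       e1 + F (w0 + k^-1 *: x) *: e2 + pr (w0 + k^-1 *: x).
      by move/FU; rewrite ltxx.
    rewrite prD prZ /Q /b /rhs; vec; field.
    exact: k0'.
  (* The factors [ka] and [ka^-1] yield the two opposite inequalities. *)
  have ka0 : 0 < ka by lra.
  have H1 := step _ ka0 dU.
  have kaV0 : 0 < ka^-1 by rewrite invr_gt0.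
  have H2 := step _ kaV0 dU'.
  move=> v; apply/eqP; rewrite eq_le; apply/andP; split.
    by have := H2 v; rewrite invrK; lra.
  have := H1 (ka *: v); rewrite scalerA mulVf ?gt_eqF // scale1r.
  rewrite prZ (scalZ al'_lin) => H.
  have {}H : ka ^+ 2 * F (w0 + v) <= ka ^+ 2 * (F w0 +
      ka^-1 ^+ 2 * (F (w0 + ka *: v) - F w0) +
      (ka^-1 ^+ 2 - ka^-1) * (ka * al' (pr v))).
    by rewrite ler_wpM2l // sqr_ge0.
  rewrite -subr_ge0 in H; rewrite -subr_ge0; congr (0 <= _): H.
  by field; rewrite gt_eqF.
have F_quad := self_similar_quadratic F0 F_ge0 F_lip F_sim.
exists F; split=> // [v a b|v].
  apply: F_pr; rewrite !prD !prZ.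
  have -> : pr e1 = 0 by rewrite /pr -!lock d1 d3; vec; ring.
  have -> : pr e2 = 0 by rewrite /pr -!lock d2 d4; vec; ring.
  by rewrite !scaler0 !addr0.
have decomp : 0 < alpha v -> (alpha v)^-1 *: v =
    e1 + (beta v / alpha v) *: e2 + pr ((alpha v)^-1 *: v).
  by move=> a0; rewrite prZ /pr -!lock; vec; field; rewrite gt_eqF.
have Fscale : 0 < alpha v ->
    (F ((alpha v)^-1 *: v) < beta v / alpha v) = (F v < alpha v * beta v).
  move=> a0; rewrite F_quad.2 ltr_pdivlMr //.
  rewrite -(ltr_pM2l a0 (_ * _)).
  by congr (_ < _); field; rewrite gt_eqF.
split=> [Uv|[a0 ltF]].
  have a0 : 0 < alpha v.
    have [d d0 Ud] := cone_open cU (- e1) Uv.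
    have := alpha_ge0 (cone_recession Ud).
    by rewrite alphaD alphaZ (scalN (dil_lin dl)) d1; lra.
  split=> //; rewrite -Fscale //; apply/FU; rewrite -decomp //.
  by apply: coneZ => //; rewrite invr_gt0.
have -> : v = alpha v *: ((alpha v)^-1 *: v).
  by rewrite scalerA divff ?scale1r // gt_eqF.
by apply: coneZ => //; rewrite decomp //; apply/FU; rewrite Fscale.
Qed.

End Quadric.

End ProperCone.

(** * The cone over a symmetric convex body *)

Section Homogenization.
Context {R : realType} {n : nat}.
Implicit Types (x y z : 'rV[R]_n) (u v w e p : 'rV[R]_(n + 1)).
Implicit Types a b c d s t : R.

Definition height v : R := rsubmx v 0 0.
Definition hvec y t : 'rV[R]_(n + 1) := row_mx y t%:M.

Lemma height_hvec y t : height (hvec y t) = t.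
Proof. by rewrite /height row_mxKr mxE eqxx mulr1n. Qed.

Lemma base_hvec y t : lsubmx (hvec y t) = y.
Proof. exact: row_mxKl. Qed.

Lemma hvecK v : hvec (lsubmx v) (height v) = v.
Proof.
rewrite /hvec /height -[RHS]hsubmxK; congr row_mx.
by rewrite -mx11_scalar.
Qed.

Lemma height_lin : scalar height.
Proof. by move=> a u v; rewrite /height linearP !mxE. Qed.

Lemma hvecD y z s t : hvec y s + hvec z t = hvec (y + z) (s + t).
Proof. by rewrite /hvec add_row_mx raddfD. Qed.

Lemma hvecZ a y t : a *: hvec y t = hvec (a *: y) (a * t).
Proof. by rewrite /hvec scale_row_mx scale_scalar_mx. Qed.

(* If [0] is interior to the convex set [M], this is the interior of the cone
   over [M] placed at height 1. *)
Definition cone_over (M : set 'rV[R]_n) : set 'rV[R]_(n + 1) :=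
  [set v | exists s y, [/\ 0 <= s < height v, M y & lsubmx v = s *: y]].

Section Body.
Variable M : set 'rV[R]_n.
Hypotheses (bodyM : convex_body M) (symM : origin_symmetric M).

Lemma body_convex y z t : M y -> M z -> 0 <= t <= 1 ->
  M (t *: y + (1 - t) *: z).
Proof.
move=> My Mz /andP[t0 t1]; have [_ cM _] := bodyM.
have := cM y z (Itv01 t0 t1); rewrite !inE => H.
exact: H My Mz.
Qed.

Lemma body_opp y : M y -> M (- y).
Proof. by move=> My; rewrite symM; exists y. Qed.

Lemma body_closed : closed M.
Proof. by have [cM _ _] := bodyM; apply: compact_closed. Qed.

Lemma body_ball0 : exists2 r : R, 0 < r & forall y, `|y| < r -> M y.
Proof.
have [_ _ [p Mp]] := bodyM.
move/nbhs_ballP: Mp => [r /= r0 pM]; exists (r / 2); first by rewrite divr_gt0.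
move=> y yr.
have -> : y = 2^-1 *: (p + 2 *: y) + (1 - 2^-1) *: (- p) by vec; field.
have pM' z : `|p - z| < r -> M z by move=> pz; apply: pM; rewrite -ball_normE.
apply: body_convex; last by apply/andP; split; lra.
  apply: pM'; rewrite opprD addNKr normrN normrZ gtr0_norm //.
  by rewrite mulrC -ltr_pdivlMr.
by apply: body_opp; apply: pM'; rewrite subrr normr0.
Qed.

Lemma body0 : M 0.
Proof. by have [r r0 H] := body_ball0; apply: H; rewrite normr0. Qed.

Lemma bodyZ t y : 0 <= t <= 1 -> M y -> M (t *: y).
Proof.
by move=> t01 My; have := body_convex My body0 t01; rewrite scaler0 addr0.
Qed.

Lemma body_bounded : exists2 B : R, 0 < B & forall y, M y -> `|y| <= B.
Proof.
have [cM _ _] := bodyM; have [B [_ HB]] := compact_bounded cM.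
exists (`|B| + 1); first by rewrite ltr_wpDl.
by move=> y My; apply: HB => //; rewrite (le_lt_trans (ler_norm _)) // ltrDl.
Qed.

Lemma cone_overD u v : cone_over M u -> cone_over M v -> cone_over M (u + v).
Proof.
move=> [s [y [/andP[s0 su] My Eu]]] [t [z [/andP[t0 tv] Mz Ev]]].
have hD := scalD height_lin u v.
have [st0|st0] := eqVneq (s + t) 0.
  exists 0, 0; split; [apply/andP; split; lra|exact: body0|].
  have s00 : s = 0 by lra.
  have t00 : t = 0 by lra.
  by rewrite linearD /= Eu Ev s00 t00 !scale0r addr0.
have st1 : 0 < s + t by rewrite lt_neqAle eq_sym st0 addr_ge0.
exists (s + t), ((s / (s + t)) *: y + (1 - s / (s + t)) *: z); split.
- by apply/andP; split; lra.
- by apply: body_convex; rewrite // divr_ge0 ?ler_pdivrMr //=; lra.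
- by rewrite linearD /= Eu Ev; vec; field.
Qed.

Lemma cone_overZ k u : 0 < k -> cone_over M u -> cone_over M (k *: u).
Proof.
move=> k0 [s [y [/andP[s0 su] My Eu]]]; exists (k * s), y; split=> //.
  by rewrite (scalZ height_lin) mulr_ge0 ?(ltW k0) //= ltr_pM2l.
by rewrite linearZ /= Eu scalerA.
Qed.

Lemma cone_over_vertical t : 0 < t -> cone_over M (hvec 0 t).
Proof.
move=> t0; exists 0, 0; split; rewrite ?height_hvec ?lexx //.
  exact: body0.
by rewrite base_hvec scaler0.
Qed.

Lemma cone_over_open p v : cone_over M p ->
  exists2 d, 0 < d & cone_over M (p + d *: v).
Proof.
move=> [s [y [/andP[s0 st] My Ep]]]; have [r r0 Hr] := body_ball0.
pose k := r / (`|lsubmx v| + 1).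
have k0 : 0 < k by rewrite divr_gt0 // ltr_wpDl.
have Mk : M (k *: lsubmx v).
  apply: Hr; rewrite normrZ gtr0_norm // /k mulrAC ltr_pdivrMr ?ltr_wpDl //.
  by rewrite ltr_pM2l // ltrDl.
(* Half of the slack [t - s] in height is spent on the perturbation: [d * N = (t - s) / 2], where
   [N] covers both the base and the height of [v]. *)
pose t := height p; pose N := k^-1 + `|height v| + 1.
have N0 : 0 < N by rewrite ltr_wpDl // addr_ge0 // invr_ge0 ltW.
pose d := (t - s) / (2 * N).
have d0 : 0 < d by rewrite divr_gt0 ?mulr_gt0 ?subr_gt0.
exists d => //.
have dN : d * N = (t - s) / 2 by rewrite /d; field; rewrite gt_eqF.
rewrite -[p]hvecK -[v]hvecK hvecZ hvecD.
have -> : hvec (lsubmx p + d *: lsubmx v) (height p + d * height v) =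
    hvec (lsubmx p) ((s + t) / 2) +
    hvec (d *: lsubmx v) ((t - s) / 2 + d * height v).
  by rewrite hvecD; congr hvec; rewrite /t; field.
apply: cone_overD.
  exists s, y; rewrite height_hvec base_hvec; split=> //.
  by rewrite s0 /=; rewrite -/t in st; lra.
exists (d * k^-1), (k *: lsubmx v); rewrite height_hvec base_hvec; split=> //.
  rewrite mulr_ge0 ?invr_ge0 ?(ltW d0) ?(ltW k0) //=.
  have hv : 0 <= `|height v| + height v.
    by have := ler_norm (- height v); rewrite normrN; lra.
  have := mulr_ge0 (ltW d0) hv; rewrite -dN /N; lra.
by rewrite scalerA mulfVK // gt_eqF.
Qed.

Lemma height_cone v : cone_over M v -> 0 < height v.
Proof. by move=> [s [y [/andP[s0 sv] _ _]]]; lra. Qed.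

Lemma height_recession v : recession (cone_over M) v -> 0 <= height v.
Proof.
move=> Cv; rewrite leNgt; apply/negP => hv.
have h0 : 0 < - height v by lra.
have := height_cone (Cv _ (cone_over_vertical h0)).
by rewrite (scalD height_lin) height_hvec addNr ltxx.
Qed.

Lemma recession_height0 v : recession (cone_over M) v -> height v = 0 -> v = 0.
Proof.
move=> Cv hv; have [B B0 HB] := body_bounded.
suff lv : lsubmx v = 0 by rewrite -[v]hvecK lv hv /hvec raddf0 row_mx0.
apply/eqP; rewrite -normr_le0 leNgt; apply/negP => lv.
have e0 : 0 < `|lsubmx v| / B by rewrite divr_gt0.
have := Cv _ (cone_over_vertical e0).
rewrite -{2}[v]hvecK hvecD add0r hv addr0.
move=> [s [y [/andP[s0]]]]; rewrite height_hvec base_hvec => sl My E.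
move: sl; rewrite ltr_pdivlMr // E normrZ ger0_norm // => H.
by have := ler_wpM2l s0 (HB _ My); rewrite leNgt H.
Qed.

Lemma cone_over_proper : proper_cone (cone_over M).
Proof.
split.
- exact: cone_overD.
- exact: cone_overZ.
- exact: cone_over_open.
- move=> v Cv CNv; apply: (recession_height0 Cv); apply/eqP; rewrite eq_le.
  rewrite height_recession // andbT -oppr_ge0 -(scalN height_lin).
  exact: height_recession.
Qed.

Lemma interior_cone y : M° y <-> cone_over M (hvec y 1).
Proof.
split=> [My|[s [z []]]].
  move/nbhs_ballP: My => [r /= r0 yM].
  pose d := r / (`|y| + 1).
  have d0 : 0 < d by rewrite divr_gt0 // ltr_wpDl.
  exists (1 + d)^-1, ((1 + d) *: y); rewrite height_hvec base_hvec; split.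
  - by rewrite invr_ge0 invf_lt1; [apply/andP; split|]; lra.
  - apply: yM; rewrite -ball_normE /=.
    have -> : y - (1 + d) *: y = - (d *: y) by vec; ring.
    rewrite normrN normrZ gtr0_norm // /d mulrAC ltr_pdivrMr ?ltr_wpDl //.
    by rewrite ltr_pM2l // ltrDl.
  - by rewrite scalerA mulVf ?scale1r //; apply/eqP; lra.
rewrite height_hvec base_hvec => /andP[s0 s1] Mz ->.
have [r r0 Hr] := body_ball0.
apply/nbhs_ballP; exists ((1 - s) * r).
  by rewrite /= mulr_gt0 // subr_gt0.
move=> x; rewrite -ball_normE /= => xr.
have s10 : 1 - s != 0 by apply/eqP; lra.
have -> : x = s *: z + (1 - s) *: ((1 - s)^-1 *: (x - s *: z)).
  by vec; field.
apply: body_convex => //; last by rewrite s0 ltW.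
apply: Hr; rewrite normrZ gtr0_norm ?invr_gt0 ?subr_gt0 // distrC mulrC.
by rewrite ltr_pdivrMr ?subr_gt0 // mulrC.
Qed.

(** If [hvec y 1] is in the closure of the cone, raising it by [d] puts [(1 + d)^-1 *: y] in [M] for
    arbitrarily small [d], and [M] is closed. *)
Lemma body_recession y : M y <-> recession (cone_over M) (hvec y 1).
Proof.
split=> [My p|Cy].
  move=> [s [z [/andP[s0 sp] Mz Ep]]].
  have s10 : s + 1 != 0 by apply/eqP; lra.
  exists (s + 1), ((s / (s + 1)) *: z + (1 - s / (s + 1)) *: y).
  rewrite (scalD height_lin) height_hvec; split.
  - by apply/andP; split; lra.
  - apply: body_convex => //.
    by rewrite divr_ge0 ?ler_pdivrMr //=; lra.
  - by rewrite linearD /= Ep base_hvec; vec; field.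
rewrite (closure_id M).1; last exact: body_closed.
move=> A /nbhs_ballP [r /= r0 yA].
pose d := r / (`|y| + 1).
have d0 : 0 < d by rewrite divr_gt0 // ltr_wpDl.
exists ((1 + d)^-1 *: y); split.
  have [s [z []]] := Cy _ (cone_over_vertical d0).
  rewrite hvecD height_hvec base_hvec add0r => /andP[s0 sd] Mz ->.
  rewrite scalerA; apply: bodyZ => //.
  by rewrite mulrC divr_ge0 ?ler_pdivrMr //=; lra.
apply: yA; rewrite -ball_normE /=.
have d1 : 1 + d != 0 by apply/eqP; lra.
have -> : y - (1 + d)^-1 *: y = (d / (1 + d)) *: y by vec; field.
rewrite normrZ gtr0_norm ?divr_gt0 //; last by lra.
apply: (@le_lt_trans _ _ (d * `|y|)).
  by rewrite ler_wpM2r // ler_pdivrMr ?ler_peMr //; lra.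
rewrite /d mulrAC ltr_pdivrMr ?ltr_wpDl //.
by rewrite ltr_pM2l // ltrDl.
Qed.

Lemma boundary_cone y : boundary M y <->
  recession (cone_over M) (hvec y 1) /\ ~ cone_over M (hvec y 1).
Proof.
rewrite /boundary -(closure_id M).1; last exact: body_closed.
by rewrite -body_recession -interior_cone.
Qed.

Lemma ray_boundary y z : M° y -> z != 0 ->
  exists2 s, 0 < s & boundary M (y + s *: z).
Proof.
move=> /interior_cone Uy z0.
have Nz : ~ recession (cone_over M) (hvec z 0).
  move/recession_height0; rewrite height_hvec => /(_ erefl) Ez.
  by move: z0; rewrite -(base_hvec z 0) Ez linear0 eqxx.
have [s [s0]] := cone_exit cone_over_proper Uy Nz.
rewrite hvecZ hvecD mulr0 addr0 => Cs Ns; exists s => //.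
exact/boundary_cone.
Qed.

End Body.
End Homogenization.

(** * Products of two reflections *)

Section Reflections.
Context {R : realType} {m : nat}.
Implicit Types (e x v : 'rV[R]_m).
Variable U : set 'rV[R]_m.

Definition reflection (phi : 'rV[R]_m -> R) x v := v - (2 * phi v) *: x.

(** [phi] is normalized so that its reflection sends [e] to [- (d / c) *: e'], a positive multiple,
    and [e'] to [- (c / d) *: e]; likewise for [phi']. The product of the two therefore scales [e]
    by [kap^-1] and [e'] by [kap]. *)
Lemma dilation_of_reflections e e' x x' (c d c' d' : R)
    (phi phi' : 'rV[R]_m -> R) :
  scalar phi -> scalar phi' ->
  c < 0 < d -> d' < 0 < c' -> 1 < d * c' / (c * d') ->
  x = c *: e + d *: e' -> x' = c' *: e + d' *: e' ->
  c * phi e = 2^-1 -> d * phi e' = 2^-1 ->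
  c' * phi' e = 2^-1 -> d' * phi' e' = 2^-1 ->
  (forall v, U v -> U (reflection phi x v)) ->
  (forall v, U v -> U (reflection phi' x' v)) ->
  exists alpha beta lam, dilation U e e' alpha beta lam.
Proof.
move=> pl pl' /andP[c0 d0] /andP[d'0 c'0] kap1 Ex Ex' pe pe' p'e p'e' rU rU'.
set kap := d * c' / (c * d') in kap1.
have [cn [dn [c'n d'n]]] : c != 0 /\ d != 0 /\ c' != 0 /\ d' != 0.
  by do !split; apply/eqP; lra.
have {}pe : phi e = (2 * c)^-1 by apply: (mulfI cn); rewrite pe; field.
have {}pe' : phi e' = (2 * d)^-1 by apply: (mulfI dn); rewrite pe'; field.
have {}p'e : phi' e = (2 * c')^-1 by apply: (mulfI c'n); rewrite p'e; field.
have {}p'e' : phi' e' = (2 * d')^-1 by apply: (mulfI d'n); rewrite p'e'; field.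
have kapn : kap - 1 != 0 by apply/eqP; lra.
have kap0 : kap != 0 by apply/eqP; lra.
have dcn : d * c' - c * d' != 0.
  apply: contra kapn => /eqP H; rewrite /kap.
  have -> : d * c' = c * d' by lra.
  by rewrite divff ?subrr // mulf_neq0.
have dcn' : c * d' - d * c' != 0 by rewrite -oppr_eq0 opprB.
(* The forms are read off from the product: minus the identity it has the coefficients
   [(kap^-1 - 1) * alpha v] on [e] and [(kap - 1) * beta v] on [e']. *)
pose alpha v := (2 * (c' * d / d') * phi v - 2 * c' * phi' v) / (kap - 1).
pose beta v := (2 * (d' * c / c') * phi v - 2 * d' * phi' v) / (kap^-1 - 1).
have kapVn : kap^-1 - 1 != 0.
  by rewrite subr_eq0 invr_eq1; apply: contra kapn => /eqP->; rewrite subrr.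
exists alpha, beta, kap; split=> //.
- by move=> a u v; rewrite /alpha pl pl'; ring.
- by move=> a u v; rewrite /beta pl pl'; ring.
- rewrite /alpha /beta pe pe' p'e p'e' /kap; split; field;
  by rewrite ?mulN1r ?cn ?dn ?c'n ?d'n ?dcn ?dcn'.
- move=> v /rU'/rU; congr U; rewrite /reflection /dilate Ex Ex'.
  rewrite !(scalD pl, scalD pl', scalZ pl, scalZ pl', scalN pl, scalN pl').
  rewrite ?pe ?pe' ?p'e ?p'e' /alpha /beta /kap; vec; field;
  by rewrite ?mulN1r ?cn ?dn ?c'n ?d'n ?dcn ?dcn'.
- move=> v /rU/rU'; congr U; rewrite /reflection /dilate Ex Ex'.
  rewrite !(scalD pl, scalD pl', scalZ pl, scalZ pl', scalN pl, scalN pl').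
  rewrite ?pe ?pe' ?p'e ?p'e' /alpha /beta /kap; vec; field;
  by rewrite ?mulN1r ?cn ?dn ?c'n ?d'n ?dcn ?dcn'.
Qed.

End Reflections.

(** * Poles and the reflections they induce *)

Section Poles.
Context {R : realType} {n : nat}.
Implicit Types (x y z A B : 'rV[R]_n) (u v w e p : 'rV[R]_(n + 1)).
Implicit Types a b c d s t : R.
Variable L : set 'rV[R]_n.
Hypotheses (bodyL : convex_body L) (symL : origin_symmetric L).
Let U := cone_over L.
Let cU : proper_cone U := cone_over_proper bodyL symL.

Lemma opposite_height e e' : opposite U e e' -> 0 < height e.
Proof.
move=> [Ce Ce' Ne Ne' Uee'].
rewrite lt_neqAle (height_recession bodyL symL Ce) andbT eq_sym.
apply/eqP => h0; apply: Ne'.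
by move: Uee'; rewrite (recession_height0 bodyL symL Ce h0) add0r.
Qed.

Lemma opposite_scale e e' a b : 0 < a -> 0 < b -> opposite U e e' ->
  opposite U (a *: e) (b *: e').
Proof.
move=> a0 b0 [Ce Ce' Ne Ne' Uee'].
have scaleN k v : 0 < k -> ~ U v -> ~ U (k *: v).
  move=> k0 Nv Ukv; apply: Nv.
  have -> : v = k^-1 *: (k *: v) by rewrite scalerA mulVf ?scale1r ?gt_eqF.
  by apply: (coneZ cU); rewrite ?invr_gt0.
split; [exact: (recessionZ cU (ltW a0)) | exact: (recessionZ cU (ltW b0))
  | exact: scaleN | exact: scaleN |].
by apply: (cone_combination cU Ce Ce' ltr01 ltr01) => //; rewrite !scale1r.
Qed.

Lemma opposite_hvec e e' : opposite U e e' -> exists A B,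
  [/\ e = height e *: hvec A 1, e' = height e' *: hvec B 1 &
      opposite U (hvec A 1) (hvec B 1)].
Proof.
move=> op; have h := opposite_height op.
have h' := opposite_height (opposite_sym op).
have E v : 0 < height v -> (height v)^-1 *: v =
    hvec ((height v)^-1 *: lsubmx v) 1.
  by move=> v0; rewrite -{2}[v]hvecK hvecZ mulVf ?gt_eqF.
exists ((height e)^-1 *: lsubmx e), ((height e')^-1 *: lsubmx e').
rewrite -!E // !scalerA !divff ?gt_eqF // !scale1r; split=> //.
by apply: opposite_scale; rewrite ?invr_gt0.
Qed.

Lemma opposite_free e e' : opposite U e e' -> free [:: e; e'].
Proof.
move=> op; have [Ce Ce' Ne Ne' Uee'] := op.
have h := opposite_height op; have h' := opposite_height (opposite_sym op).
have e'0 : e' != 0.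
  by apply/eqP => E; move: h'; rewrite E (scal0 height_lin) ltxx.
rewrite free_cons seq1_free e'0 andbT span_seq1.
apply/vlineP => -[k Ek]; apply: Ne'.
have k0 : 0 < k by move: h; rewrite Ek (scalZ height_lin) pmulr_lgt0.
have -> : e' = (k + 1)^-1 *: (e + e').
  by rewrite Ek; vec; field; apply/eqP; lra.
by apply: (coneZ cU) => //; rewrite invr_gt0; lra.
Qed.

(** Provides the secant hypothesis of [is_polar]: points of the line between [A] and [B] are
    interior, and points beyond them are outside [L]. *)
Lemma opposite_line A B : opposite U (hvec A 1) (hvec B 1) ->
  boundary L `&`
    [set y | (affine_point y <= <<[:: hvec A 1; hvec B 1]>>)%VS] = [set A; B].
Proof.
move=> op; have [CA CB NA NB UAB] := op.
have UAB1 : U (1 *: hvec A 1 + 1 *: hvec B 1) by rewrite !scale1r.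
have lineP y : (affine_point y <= <<[:: hvec A 1; hvec B 1]>>)%VS <->
    exists a b, hvec y 1 = a *: hvec A 1 + b *: hvec B 1.
  rewrite /affine_point -memvE span_cons span_seq1; split.
    move/memv_addP => [u /vlineP[a ->] [v /vlineP[b ->] E]].
    by exists a, b.
  move=> [a [b E]]; change (hvec y 1 \in (<[hvec A 1]> + <[hvec B 1]>)%VS).
  by rewrite E memv_add // memvZ // memv_line.
have combP y a b : hvec y 1 = a *: hvec A 1 + b *: hvec B 1 ->
    a + b = 1 /\ y = a *: A + b *: B.
  move=> E; split.
    have := congr1 height E.
    by rewrite (scalD height_lin) !(scalZ height_lin) !height_hvec !mulr1.
  by have := congr1 lsubmx E; rewrite linearD !linearZ /= !base_hvec.
(* For [a < 0], adding [(- a) *: e + e'] to the point would put [(b + 1) *: e'] in [U], so no point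
   of the line beyond [e'] lies in the closure. *)
have side e e' a b y : recession U e -> recession U e' -> ~ U e' ->
    U (1 *: e + 1 *: e') -> recession U (hvec y 1) -> a < 0 -> 0 < b ->
    hvec y 1 = a *: e + b *: e' -> False.
  move=> Ce Ce' Ne' Ue Cy a0 b0 E; apply: Ne'.
  have : U ((- a) *: e + 1 *: e').
    by apply: (cone_combination cU Ce Ce' ltr01 ltr01 Ue) => //; lra.
  move/Cy; rewrite E => /(coneZ cU (k := (b + 1)^-1)).
  rewrite invr_gt0 => /(_ (addr_gt0 b0 ltr01)); congr U.
  by vec; field; apply/eqP; lra.
apply/seteqP; split=> y /=.
  move=> [/(boundary_cone bodyL symL)[Cy Ny] /lineP[a [b E]]].
  have [ab1 Ey] := combP _ _ _ E.
  have [a0|a0|a0] := ltgtP a 0.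
  - by exfalso; apply: (side _ _ a b y CA CB NB) => //; lra.
  - have [b0|b0|b0] := ltgtP b 0.
    + exfalso; apply: (side _ _ b a y CB CA NA) => //; first by rewrite addrC.
      by rewrite addrC.
    + exfalso; apply: Ny; rewrite E.
      exact: (cone_combination cU CA CB ltr01 ltr01).
    + left; rewrite Ey b0 scale0r addr0.
      have aE : a = 1 by lra.
      by rewrite aE scale1r.
  - right; rewrite Ey a0 scale0r add0r.
    have bE : b = 1 by lra.
    by rewrite bE scale1r.
case=> ->; split; try exact/(boundary_cone bodyL symL); apply/lineP.
  by exists 1, 0; rewrite scale1r scale0r addr0.
by exists 0, 1; rewrite scale1r scale0r add0r.
Qed.

(** A cross ratio of -1 makes the point of [H] on the line the harmonic conjugate [c *: e - d *: e']
    of [x]. If [x] were in [H] too, so would the whole line be, whereas it meets [H] in one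
    point. *)
Lemma polar_harmonic x H e e' c d :
  is_polar L (affine_point x) H -> ~ L x -> opposite U e e' ->
  hvec x 1 = c *: e + d *: e' -> hvec x 1 \notin H /\ c *: e - d *: e' \in H.
Proof.
move=> polH NLx op.
have [A [B [EA EB opAB]]] := opposite_hvec op.
rewrite {op}EA {}EB !scalerA.
move: (c * height e) (d * height e') => {}c {}d {e e'} Ex.
have [CA CB NA NB UAB] := opAB.
have fAB := opposite_free opAB.
have AB : A != B.
  apply/eqP => E; apply: NA; move: UAB; rewrite E => UBB.
  have -> : hvec B 1 = 2^-1 *: (hvec B 1 + hvec B 1) by vec; field.
  by apply: (coneZ cU); rewrite ?invr_gt0.
have cd1 : c + d = 1.
  have := congr1 height Ex.
  by rewrite (scalD height_lin) !(scalZ height_lin) !height_hvec !mulr1.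
have LA : L A by apply/(body_recession bodyL symL).
have LB : L B by apply/(body_recession bodyL symL).
have xE : x = c *: A + d *: B.
  by have := congr1 lsubmx Ex; rewrite linearD !linearZ /= !base_hvec.
have c0 : c != 0.
  apply/eqP => c0; apply: NLx; rewrite xE c0 scale0r add0r.
  have dE : d = 1 by lra.
  by rewrite dE scale1r.
have d0 : d != 0.
  apply/eqP => d0; apply: NLx; rewrite xE d0 scale0r addr0.
  have cE : c = 1 by lra.
  by rewrite cE scale1r.
set l := <<[:: hvec A 1; hvec B 1]>>%VS.
have Al : hvec A 1 \in l by rewrite memv_span // !inE eqxx.
have Bl : hvec B 1 \in l by rewrite memv_span // !inE eqxx orbT.
have dl : \dim l = 2 by apply/eqP; rewrite -[2]/(size [:: hvec A 1; hvec B 1]).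
have xl : (affine_point x <= l)%VS.
  rewrite /affine_point -memvE; change (hvec x 1 \in l).
  by rewrite Ex memvD // memvZ.
have [pt cr] := polH l A B dl xl AB (opposite_line opAB).
have [z zl0 lHE] : exists2 z, z != 0 & (l :&: H = <[z]>)%VS.
  exists (vpick (l :&: H)%VS).
    by rewrite vpick0 -dimv_eq0 pt.
  apply/esym/eqP; rewrite eqEdim dim_vline vpick0 -dimv_eq0 pt andbT.
  by rewrite -memvE memv_pick.
have : z \in (l :&: H)%VS by rewrite lHE memv_line.
rewrite memv_cap => /andP[zl zH].
have [z0 [z1 zE]] : exists z0 z1 : R, z = z0 *: hvec A 1 + z1 *: hvec B 1.
  move: zl; rewrite /l span_cons span_seq1.
  move/memv_addP => [u /vlineP[a ->] [v /vlineP[b ->] E]].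
  by exists a, b.
have xn0 : c *: hvec A 1 + d *: hvec B 1 != 0.
  rewrite -Ex; apply/eqP => E; have := congr1 height E.
  by rewrite height_hvec (scal0 height_lin) => /eqP; rewrite oner_eq0.
have zn0 : z0 *: hvec A 1 + z1 *: hvec B 1 != 0 by rewrite -zE.
have := cross_ratioE fAB xn0 zn0.
rewrite -zE -Ex -lHE.
change (cross_ratio <[hvec A 1]> <[hvec B 1]> <[hvec x 1]> (l :&: H)%VS =
  d * z0 / (c * z1) ->
  hvec x 1 \notin H /\ c *: hvec A 1 - d *: hvec B 1 \in H).
rewrite [LHS]cr => crE.
(* With [z1 = 0] the denominator vanishes and the cross ratio takes its default value 0, not -1. *)
have z10 : z1 != 0.
  apply/eqP => z10; move: crE; rewrite z10 mulr0 invr0 mulr0 => /eqP.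
  by rewrite oppr_eq0 oner_eq0.
have dz : d * z0 = - (c * z1).
  have cz : c * z1 != 0 by rewrite mulf_neq0.
  by apply: (mulIf (invr_neq0 cz)); rewrite -crE mulNr divff.
have cH : c *: hvec A 1 - d *: hvec B 1 \in H.
  suff -> : c *: hvec A 1 - d *: hvec B 1 = (- d / z1) *: z by rewrite memvZ.
  rewrite zE scalerDr !scalerA.
  have -> : - d / z1 * z0 = c.
    by rewrite mulrAC mulNr dz opprK mulfK.
  by rewrite -[X in _ + X]scaleNr divfK.
split=> //; apply/negP => xH.
have AH : hvec A 1 \in H.
  have -> : hvec A 1 = (2 * c)^-1 *:
      (hvec x 1 + (c *: hvec A 1 - d *: hvec B 1)) by rewrite Ex; vec; field.
  by rewrite memvZ // memvD.
have BH : hvec B 1 \in H.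
  have -> : hvec B 1 = d^-1 *: (hvec x 1 - c *: hvec A 1).
    by rewrite Ex addrAC subrr add0r scalerA mulVf ?scale1r.
  by rewrite memvZ // memvB // memvZ.
have lH : (l <= H)%VS.
  by apply/span_subvP => u; rewrite !inE => /orP[] /eqP->.
by have := pt; rewrite /proj_point (capv_idPl lH) dl.
Qed.

(** The line through [v] in direction [hvec x 1] leaves [U] on both sides: [x] is outside the body,
    and [- hvec x 1] has negative height. As [v] lies between the exit points, their sector runs
    through [U]. *)
Lemma opposite_through x v : ~ L x -> U v -> exists s s',
  [/\ 0 < s, 0 < s' & opposite U (v + s *: hvec x 1) (v - s' *: hvec x 1)].
Proof.
move=> NLx Uv.
have Nx : ~ recession U (hvec x 1) by move/(body_recession bodyL symL).
have Nx' : ~ recession U (- hvec x 1).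
  move/(height_recession bodyL symL); rewrite (scalN height_lin) height_hvec.
  lra.
have [s [s0 Cs Ns]] := cone_exit cU Uv Nx.
have [s' [s'0 Cs' Ns']] := cone_exit cU Uv Nx'.
rewrite scalerN in Cs' Ns'.
exists s, s'; split=> //; split=> //.
rewrite -[X in U (X + _)]scale1r -[X in U (_ + X)]scale1r.
have ss : s + s' != 0 by apply/eqP; lra.
apply: (@cone_combination _ _ _ cU _ _ (s' / (s + s')) (s / (s + s')) 1 1)
  => //.
- by rewrite divr_gt0 // addr_gt0.
- by rewrite divr_gt0 // addr_gt0.
- by move: Uv; congr U; vec; field.
Qed.

Lemma hyperplane_form x (H : {vspace 'rV[R]_(n + 1)}) : hvec x 1 \notin H ->
  exists phi, [/\ scalar phi, phi (hvec x 1) = 1 &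
    forall h, h \in H -> phi h = 0].
Proof.
move=> xH.
have dis : (<[hvec x 1]> :&: H = 0)%VS.
  apply/eqP; rewrite -subv0; apply/subvP => u; rewrite memv_cap.
  move=> /andP[/vlineP[k ->] kH]; have [->|k0] := eqVneq k 0.
    by rewrite scale0r mem0v.
  by case/negP: xH; rewrite -[hvec x 1](scalerK k0) memvZ.
exists (fun v => height (daddv_pi <[hvec x 1]> H v)); split.
- by move=> a u v; rewrite linearP height_lin.
- by rewrite daddv_pi_id ?memv_line // height_hvec.
- move=> h hH; have dis' : (H :&: <[hvec x 1]> = 0)%VS by rewrite capvC.
  have := daddv_pi_add dis (subvP (addvSr _ _) _ hH).
  rewrite (daddv_pi_id dis' hH) => /(canRL (addrK _)); rewrite subrr => ->.
  exact: scal0 height_lin.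
Qed.

(** The form that is 1 at [hvec x 1] and 0 on the polar does it: [c * phi e] and [d * phi e'] have
    sum 1 and difference 0. *)
Lemma pole_form x : is_pole L (affine_point x) -> ~ L x ->
  exists2 phi : 'rV[R]_(n + 1) -> R, scalar phi & forall e e' c d,
    opposite U e e' -> hvec x 1 = c *: e + d *: e' ->
    c * phi e = 2^-1 /\ d * phi e' = 2^-1.
Proof.
move=> [_ [H _ polH]] NLx.
(* One secant, through the vertical vector [hvec 0 1], shows that [x] is not on its polar. *)
have [s [s' [s0 s'0 op]]] :=
  opposite_through NLx (cone_over_vertical bodyL symL ltr01).
have ss : s + s' != 0 by apply/eqP; lra.
have Ex : hvec x 1 = (s + s')^-1 *: (hvec 0 1 + s *: hvec x 1) +
    (- (s + s')^-1) *: (hvec 0 1 - s' *: hvec x 1) by vec; field.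
have [xH _] := polar_harmonic polH NLx op Ex.
have [phi [pl px pH]] := hyperplane_form xH.
exists phi => // e e' c d op' Ex'.
have [_ /pH] := polar_harmonic polH NLx op' Ex'.
move: px; rewrite Ex' (scalD pl) (scalB pl) !(scalZ pl) => H1 H2.
by split; lra.
Qed.

(** Up to a common factor, [v] has the weights [s'] and [s] on the end points of its secant through
    [x]; its image has the weights [s] and [s'], again positive. *)
Lemma reflection_cone x (phi : 'rV[R]_(n + 1) -> R) : ~ L x -> scalar phi ->
  (forall e e' c d, opposite U e e' -> hvec x 1 = c *: e + d *: e' ->
    c * phi e = 2^-1 /\ d * phi e' = 2^-1) ->
  forall v, U v -> U (reflection phi (hvec x 1) v).
Proof.
move=> NLx pl H v Uv.
have [s [s' [s0 s'0 op]]] := opposite_through NLx Uv.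
have ss : s + s' != 0 by apply/eqP; lra.
have Ex : hvec x 1 = (s + s')^-1 *: (v + s *: hvec x 1) +
    (- (s + s')^-1) *: (v - s' *: hvec x 1) by vec; field.
have [H1 H2] := H _ _ _ _ op Ex.
have px : phi (hvec x 1) = 1.
  by rewrite Ex (scalD pl) !(scalZ pl) H1 H2; lra.
move: H1; rewrite (scalD pl) (scalZ pl) px => H1.
have pv : phi v = (s' - s) / 2.
  suff : phi v + s * 1 = (s + s') / 2 by lra.
  by apply: (mulfI (invr_neq0 ss)); rewrite H1; field.
rewrite /reflection pv.
have -> : v - (2 * ((s' - s) / 2)) *: hvec x 1 =
    (s / (s + s')) *: (v + s *: hvec x 1) +
    (s' / (s + s')) *: (v - s' *: hvec x 1) by vec; field.
have [Ce Ce' _ _ Uee'] := op.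
apply: (cone_combination cU Ce Ce' ltr01 ltr01); rewrite ?scale1r //;
by rewrite divr_gt0 // addr_gt0.
Qed.

End Poles.

(** * Positive definite forms and ellipsoids *)

Section PositiveDefinite.
Context {R : realType}.

(** Block Cholesky factorization: induction on the size, passing to the Schur complement [D'] of the
    corner [a]. *)
Lemma posdef_factor n (M : 'M[R]_n) : M^T = M ->
  (forall y : 'rV[R]_n, y != 0 -> 0 < (y *m M *m y^T) 0 0) ->
  exists T : 'M[R]_n, M = T *m T^T.
Proof.
elim: n M => [|n IH] M symM posM.
  by exists 0; apply/matrixP => -[].
rewrite -[n.+1]/(1 + n)%N in M symM posM *.
pose a := M 0 0; pose b : 'rV[R]_n := ursubmx M; pose D := drsubmx M.
have ME : M = block_mx a%:M b b^T D.
  rewrite -[LHS]submxK; congr block_mx.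
    by apply/rowP => i; rewrite !ord1 !mxE; congr (M _ _); apply/val_inj.
  by rewrite /b trmx_ursub symM.
have symD : D^T = D by rewrite /D trmx_drsub symM.
have a0 : 0 < a.
  have := posM (row_mx 1%:M 0); rewrite row_mx_eq0 negb_and.
  have -> : (1%:M : 'M[R]_1) != 0.
    by apply/eqP => /matrixP /(_ 0 0); rewrite !mxE => /eqP; rewrite oner_eq0.
  move=> /(_ isT); rewrite ME mul_row_block tr_row_mx mul_row_col.
  rewrite !mul0mx !addr0 trmx1 trmx0 mul1mx mulmx1 mulmx0 addr0.
  by rewrite mxE eqxx mulr1n.
have an : a != 0 by rewrite gt_eqF.
pose D' := D - a^-1 *: (b^T *m b).
have [|y y0|T1 ET1] := IH D'.
- by rewrite /D' linearB linearZ /= trmx_mul trmxK symD.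
(* [z] completes the square: the form of [M] at [z] equals that of [D'] at [y]. *)
- pose z : 'rV[R]_(1 + n) := row_mx (- a^-1 *: (y *m b^T)) y.
  have z0 : z != 0 by rewrite row_mx_eq0 negb_and y0 orbT.
  have := posM z z0; congr (0 < _ 0 0).
  rewrite ME mul_row_block tr_row_mx mul_row_col -!scalemxAl mul_mx_scalar.
  rewrite scalerA mulNr mulVf // scaleN1r addNr mul0mx add0r /D'.
  rewrite mulmxBr -scalemxAr mulmxA scaleNr [in RHS]mulmxBl mulmxDl.
  by rewrite mulNmx addrC.
pose r := Num.sqrt a.
have r0 : r != 0 by rewrite gt_eqF // sqrtr_gt0.
have rr : r * r = a by rewrite -expr2 sqr_sqrtr // ltW.
exists (block_mx r%:M 0 (r^-1 *: b^T) T1).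
rewrite tr_block_mx mulmx_block !trmx0 !mul0mx !mulmx0 !addr0.
rewrite !linearZ /= trmxK tr_scalar_mx -?scalemxAl -?scalemxAr.
rewrite mul_scalar_mx mul_mx_scalar scale_scalar_mx rr mul_scalar_mx.
rewrite !scalerA mulVf // !scale1r -ET1 /D' -invfM rr addrC subrK.
exact: ME.
Qed.

Lemma quadratic_form_matrix n (Q : 'rV[R]_n -> R) : quadratic_form Q ->
  exists2 M : 'M[R]_n, M^T = M & forall y, Q y = (y *m M *m y^T) 0 0.
Proof.
move=> [pl homQ].
have plC u v : polar_form Q u v = polar_form Q v u.
  by rewrite /polar_form [u + v]addrC; ring.
pose M := \matrix_(i, j) (polar_form Q (delta_mx 0 i) (delta_mx 0 j) / 2).
exists M; first by apply/matrixP => i j; rewrite !mxE plC.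
have expand y v : polar_form Q y v =
    \sum_i y 0 i * polar_form Q (delta_mx 0 i) v.
  rewrite {1}[y]row_sum_delta.
  rewrite (big_morph (polar_form Q ^~ v) (scalD (pl v)) (scal0 (pl v))).
  by apply: eq_bigr => i _; rewrite (scalZ (pl v)).
move=> y.
have -> : Q y = polar_form Q y y / 2.
  by rewrite /polar_form -mulr2n -scaler_nat homQ; field.
rewrite expand mxE mulr_suml; apply: eq_bigr => i _.
rewrite plC expand !mxE mulr_sumr !mulr_suml.
apply: eq_bigr => j _; rewrite !mxE; ring.
Qed.

Lemma posdef_ellipsoid n (Q : 'rV[R]_n -> R) : quadratic_form Q ->
  (forall y, y != 0 -> 0 < Q y) -> ellipsoid [set y | Q y <= 1].
Proof.
move=> qQ posQ; have [M symM QE] := quadratic_form_matrix qQ.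
have [|T ET] := @posdef_factor n M symM; first by move=> y /posQ; rewrite QE.
have QT y : Q y = \sum_i (y *m T) 0 i ^+ 2.
  rewrite QE ET mulmxA -mulmxA -trmx_mul mxE.
  by apply: eq_bigr => i _; rewrite [in X in _ * X]mxE -expr2.
have uT : T \in unitmx.
  rewrite -row_free_unit -kermx_eq0; apply/eqP/row_matrixP => i.
  rewrite row0; apply/eqP; apply/negPn/negP => /posQ.
  rewrite QT -row_mul mulmx_ker row0 big1 ?ltxx // => j _.
  by rewrite mxE expr0n.
exists 0, (invmx T); split; first by rewrite unitmx_inv.
apply/seteqP; split=> y /=.
  by move=> Qy; exists (y *m T); rewrite -?QT // add0r mulmxK.
by move=> [z z1 <-]; rewrite add0r QT mulmxKV.
Qed.

End PositiveDefinite.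

(** * Dilations of the cone over the body, and the conclusion *)

Section Main.
Context {R : realType} {n : nat}.
Implicit Types (x y z : 'rV[R]_n) (u v w e p : 'rV[R]_(n + 1)).

Lemma body_dilation (L K : set 'rV[R]_n) e e' :
  convex_body L -> convex_body K -> origin_symmetric L -> origin_symmetric K ->
  L `<=` K° -> (forall x, boundary K x -> is_pole L (affine_point x)) ->
  opposite (cone_over L) e e' ->
  exists alpha beta lam, dilation (cone_over L) e e' alpha beta lam.
Proof.
move=> bL bK sL sK LK poles op.
have [A [B [EA EB opAB]]] := opposite_hvec bL sL op.
have te := opposite_height bL sL op.
have te' := opposite_height bL sL (opposite_sym op).
move: (height e) (height e') te te' EA EB => t t' t0 t'0 EA EB.
have [CA CB NA NB UAB] := opAB.
have AB : B - A != 0.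
  apply/eqP => /subr0_eq E; apply: NA; move: UAB; rewrite E => UBB.
  have -> : hvec A 1 = 2^-1 *: (hvec A 1 + hvec A 1) by vec; field.
  by apply: (cone_overZ (k := 2^-1)) => //; rewrite invr_gt0.
have LA : L A by apply/(body_recession bL sL).
have LB : L B by apply/(body_recession bL sL).
have outside x : boundary K x -> ~ L x by move=> [_ N] /LK.
have [r r0 bx] := ray_boundary bK sK (LK _ LB) AB.
have BA : A - B != 0 by rewrite -oppr_eq0 opprB.
have [r' r'0 bx'] := ray_boundary bK sK (LK _ LA) BA.
have [phi pl P] := pole_form bL sL (poles _ bx) (outside _ bx).
have [phi' pl' P'] := pole_form bL sL (poles _ bx') (outside _ bx').
have tn : t != 0 by rewrite gt_eqF.
have t'n : t' != 0 by rewrite gt_eqF.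
(* The two poles lie on the line [AB], one beyond [B] and one beyond [A]; [t] and [t'] are the
   heights of [e] and [e']. *)
have Ex : hvec (B + r *: (B - A)) 1 = (- r / t) *: e + ((1 + r) / t') *: e'.
  rewrite EA EB !scalerA !divfK // !hvecZ hvecD; congr hvec; last by ring.
  by vec; ring.
have Ex' : hvec (A + r' *: (A - B)) 1 =
    ((1 + r') / t) *: e + (- r' / t') *: e'.
  rewrite EA EB !scalerA !divfK // !hvecZ hvecD; congr hvec; last by ring.
  by vec; ring.
have [P1 P2] := P _ _ _ _ op Ex; have [P1' P2'] := P' _ _ _ _ op Ex'.
apply: (dilation_of_reflections pl pl' _ _ _ Ex Ex' P1 P2 P1' P2'
  (reflection_cone bL sL (outside _ bx) pl P)
  (reflection_cone bL sL (outside _ bx') pl' P')).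
- by rewrite mulNr oppr_lt0 !divr_gt0 //; lra.
- by rewrite mulNr oppr_lt0 !divr_gt0 //; lra.
- have -> : (1 + r) / t' * ((1 + r') / t) / (- r / t * (- r' / t')) =
      (1 + r) * (1 + r') / (r * r').
    by field; rewrite tn t'n !gt_eqF.
  by rewrite ltr_pdivlMr ?mulr_gt0 //; nra.
Qed.

End Main.

Theorem theorem3 (R : realType) (n : nat) (L K : set 'rV[R]_n) :
  (3 <= n)%N ->
  convex_body L -> convex_body K ->
  origin_symmetric L -> origin_symmetric K ->
  L `<=` K° ->
  (forall x, boundary K x -> is_pole L (affine_point x)) ->
  (forall x, boundary K x ->
     support_cone L x `&` support_cone L (- x) `<=` K°) ->
  ellipsoid L.
Proof.
move=> n3 bL bK sL sK LK poles _.
pose U := cone_over L.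
have cU : proper_cone U := cone_over_proper bL sL.
have dilations e e' (op : opposite U e e') :
    exists alpha beta lam, dilation U e e' alpha beta lam.
  exact: (body_dilation bL bK sL sK LK poles op).
(* [sig] is the central symmetry of [L] lifted to the cone. *)
pose sig v : 'rV[R]_(n + 1) := hvec (- lsubmx v) (height v).
have sigD u v : sig (u + v) = sig u + sig v.
  by rewrite /sig hvecD linearD opprD (scalD height_lin).
have sigZ a v : sig (a *: v) = a *: sig v.
  by rewrite /sig hvecZ linearZ scalerN (scalZ height_lin).
have sigK v : sig (sig v) = v.
  by rewrite /sig base_hvec height_hvec opprK hvecK.
have sigU v : U v -> U (sig v).
  move=> [s [y [sh Ly E]]]; exists s, (- y); rewrite height_hvec base_hvec.
  by split=> //; [exact: body_opp|rewrite scalerN E].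
have sigC v : recession U v -> recession U (sig v).
  move=> Cv p Up; rewrite -[p]sigK -sigD.
  by apply: (sigU); apply: Cv; apply: sigU.
pose o : 'rV[R]_(n + 1) := hvec 0 1.
have Uo : U o by apply: cone_over_vertical.
have [y0 y00] : exists y : 'rV[R]_n, y != 0.
  case: n n3 {L K bL bK sL sK LK poles U cU dilations sig sigD sigZ sigK
    sigU sigC o Uo} => // k _.
  exists (const_mx 1); apply/eqP => /rowP /(_ 0); rewrite !mxE => /eqP.
  by rewrite oner_eq0.
have Ny0 : ~ recession U (hvec y0 0).
  move/(recession_height0 bL sL); rewrite height_hvec => /(_ erefl) Ez.
  by move: y00; rewrite -(base_hvec y0 0) Ez linear0 eqxx.
have [s0 [s00 Ce1 Ne1]] := cone_exit cU Uo Ny0.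
set e1 := o + _ in Ce1 Ne1.
pose e2 := sig e1.
have e12o : e1 + e2 = 2 *: o.
  rewrite /e2 /e1 /o hvecZ hvecD /sig base_hvec height_hvec hvecD hvecZ.
  by congr hvec; [rewrite add0r subrr scaler0|ring].
have op : opposite U e1 e2.
  split=> //; first exact: sigC.
    by move/sigU; rewrite sigK.
  by rewrite e12o; apply: cone_overZ.
clearbody e1.
have [alpha [beta [lam dl]]] := dilations _ _ op.
have [d1 d2 d3 d4] := dil_dual dl.
have al := dil_lin dl; have bl := dil_lin' dl.
have sig_e2 : sig e2 = e1 by rewrite /e2 sigK.
(* By uniqueness of support forms the symmetry exchanges [alpha], [beta]. *)
have alpha_sig v : alpha (sig v) = beta v.
  have psil : scalar (fun v => alpha (sig v)).
    by move=> a u w; rewrite sigD sigZ al.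
  have := support_unique cU (opposite_sym op) (dilation_sym dl) psil.
  move=> /(_ _ _ v)->; first by rewrite sig_e2 d1 mul1r.
    move=> w /sigC.
    exact: (recession_ge0 cU (opposite_sym op) (dilation_sym dl)).
  by rewrite -/e2 d2.
have alphao : alpha o = 2^-1.
  have : alpha (2 *: o) = 1 by rewrite -e12o (scalD al) d1 d2 addr0.
  by rewrite (scalZ al); lra.
have alpha_beta v : alpha v + beta v = height v.
  rewrite -alpha_sig -(scalD al).
  have -> : v + sig v = (2 * height v) *: o.
    rewrite -{1}[v]hvecK /sig hvecD /o hvecZ scaler0 subrr; congr hvec; ring.
  by rewrite (scalZ al) alphao; field.
have [F [qF F_ge0 F_e UF]] := cone_quadric cU op dl dilations.
pose f y : 'rV[R]_(n + 1) := hvec y 0.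
have fD y z : f (y + z) = f y + f z by rewrite /f hvecD addr0.
have fZ a y : f (a *: y) = a *: f y by rewrite /f hvecZ mulr0.
(* At height 1, [alpha = 2^-1 + a] and [beta = 2^-1 - a] with [a = alpha (f y)], so
   [F < alpha * beta] becomes [F + a ^+ 2 < 4^-1], that is [Q y < 1]. *)
pose Q y : R := 4 * (F (f y) + alpha (f y) ^+ 2).
have QZ a y : Q (a *: y) = a ^+ 2 * Q y.
  by rewrite /Q fZ (scalZ al) qF.2; ring.
have Q_ge0 y : 0 <= Q y by rewrite mulr_ge0 // addr_ge0 // sqr_ge0.
have qQ : quadratic_form Q.
  split=> // z a u v; have := qF.1 (f z) a (f u) (f v).
  rewrite /polar_form /Q !(fD, fZ) !(scalD al, scalZ al); lra.
have hvecE y : hvec y 1 = f y + 2^-1 *: e1 + 2^-1 *: e2.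
  rewrite -addrA -scalerDr e12o scalerA mulVf // scale1r /f /o hvecD.
  by rewrite addr0 add0r.
have UQ y : U (hvec y 1) <-> Q y < 1.
  have aE : alpha (hvec y 1) = alpha (f y) + 2^-1.
    by rewrite hvecE !(scalD al, scalZ al) d1 d2; ring.
  have bE : beta (hvec y 1) = 2^-1 - alpha (f y).
    by have := alpha_beta (hvec y 1); rewrite height_hvec aE; lra.
  have FE : F (hvec y 1) = F (f y) by rewrite hvecE F_e.
  have := F_ge0 (f y); rewrite /Q => F0; split.
    by move/UF; rewrite aE bE FE => -[H1 H2]; lra.
  move=> H; apply/UF; rewrite aE bE FE; split; last by lra.
  have := sqr_ge0 (alpha (f y)); nra.
have UQs y t : 0 < t -> Q y < t ^+ 2 -> U (hvec y t).
  move=> t0 Qt; have -> : hvec y t = t *: hvec (t^-1 *: y) 1.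
    by rewrite hvecZ scalerA divff ?scale1r ?mulr1 // gt_eqF.
  apply: (coneZ cU) => //; apply/UQ.
  by rewrite QZ exprVn mulrC ltr_pdivrMr ?mul1r // exprn_gt0.
suff -> : L = [set y | Q y <= 1].
  apply: posdef_ellipsoid => // y yn0.
  (* [Q y = 0] would make [f y] a vector of the closure at height 0, against the boundedness of
     [L]. *)
  rewrite lt_neqAle Q_ge0 andbT eq_sym; apply/eqP => Qy.
  move/eqP: yn0; apply.
  have Cf : recession U (f y).
    apply: (recession_closed cU (w := o) (u := 0)) => d d0; exists d.
      by rewrite d0 lexx.
    rewrite scaler0 addr0 /f /o hvecZ hvecD scaler0 addr0 add0r mulr1.
    by apply: (cone_recession cU); apply: UQs; rewrite // Qy exprn_gt0.
  have := recession_height0 bL sL Cf; rewrite height_hvec => /(_ erefl) fy.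
  by rewrite -(base_hvec y 0) -/(f y) fy linear0.
apply/seteqP; split=> y /=.
  move=> Ly; rewrite leNgt; apply/negP => Qy.
  have Cy := (body_recession bL sL y).1 Ly.
  (* [d] is so small that [(1 + d) ^+ 2 < Q y], while [hvec y (d + 1)] in [U] forces the reverse. *)
  pose d := (Q y - 1) / (2 * (Q y + 1)).
  have d0 : 0 < d by rewrite divr_gt0 //; lra.
  have := Cy _ (cone_over_vertical bL sL d0).
  rewrite hvecD add0r => Ud.
  have d1' : d + 1 != 0 by apply/eqP; lra.
  have : U (hvec ((d + 1)^-1 *: y) 1).
    have -> : hvec ((d + 1)^-1 *: y) 1 = (d + 1)^-1 *: hvec y (d + 1).
      by rewrite hvecZ mulVf.
    by apply: (coneZ cU) => //; rewrite invr_gt0; lra.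
  move/UQ; rewrite QZ exprVn mulrC ltr_pdivrMr ?mul1r; last first.
    by rewrite exprn_gt0 //; lra.
  have dQ : d * (2 * (Q y + 1)) = Q y - 1.
    by rewrite /d divfK //; apply/eqP; lra.
  nra.
move=> Qy; apply/(body_recession bL sL).
apply: (recession_closed cU (w := o) (u := 0)) => d d0; exists d.
  by rewrite d0 lexx.
rewrite scaler0 addr0 /o hvecZ hvecD scaler0 addr0 mulr1.
apply: (cone_recession cU); apply: UQs; first by lra.
by apply: (le_lt_trans Qy); nra.
Qed.
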